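(* Let $G$ be a finite group with an abelian subgroup of index $1$ or $2$. Let $\mathcal{N}$ denote the set of normal subgroups $N$ of $G$ such that $G/N$ is trivial, isomorphic to $C_2$, or isomorphic to a pseudodihedral group. Then $\{\mathrm{Inf}_{G/N}^G(\Phi_{G/N})\}_{N\in\mathcal{N}}$ is a basis of $B^\times(G)$ as an $\mathbb{F}_2$-vector space.
   Context: For a finite group $G$, $B(G)$ is the Burnside ring (Grothendieck ring of finite $G$-sets). For $a\in B(G)$ and $H\leq G$, $|a^H|\in\mathbb{Z}$ denotes the image of $a$ under the ring homomorphism $B(G)\to\mathbb{Z}$ induced by $[X]\mapsto |X^H|$; an element $a$ is determined by the family $(|a^H|)_{H\leq G}$. $B^\times(G)$ is the unit group of $B(G)$; it is an elementary abelian $2$-group, viewed as an $\mathbb{F}_2$-vector space. For $N\unlhd G$, $\mathrm{Inf}_{G/N}^G: B^\times(G/N)\to B^\times(G)$ is the restriction to units of the inflation ring homomorphism, so $|\mathrm{Inf}_{G/N}^G(a)^K|=|a^{KN/N}|$ for $K\leq G$. The group of faithful elements $\partial B^\times(G)$ is the intersection of the kernels of the deflation maps $B^\times(G)\to B^\times(G/N)$ for $1\neq N\unlhd G$ (the maps induced by taking $N$-fixed points); equivalently, $\partial B^\times(G)=\{u\in B^\times(G): |u^K|=1 \text{ for every } K\leq G \text{ containing a nontrivial normal subgroup of } G\}$. A finite group is pseudodihedral if it is isomorphic to $C_2\ltimes N$, where $N$ is a finite abelian group with $|N|>2$, the Sylow $2$-subgroup $N_2$ of $N$ is cyclic (possibly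 trivial), and the generator of $C_2$ acts on $N$ by inversion. If $G$ is trivial, isomorphic to $C_2$, or pseudodihedral, then $\partial B^\times(G)$ has order $2$, and $\Phi_G$ denotes its unique non-identity element. *)

(* Defs.v *)
From HB Require Import structures.
From mathcomp Require Import all_boot all_order all_algebra all_fingroup.
From mathcomp Require Import all_solvable.
From mathcomp Require Import boolp zify.

Set Implicit Arguments.
Unset Strict Implicit.
Unset Printing Implicit Defensive.

Import GRing.Theory Num.Theory.
Local Open Scope group_scope.

(* Finite G-sets are finite types with a (right) MathComp action of G.        *)

Section GSetConstructions.

Variables (gT : finGroupType) (G : {group gT}).

Definition gset_iso (T1 T2 : finType) (to1 : action G T1) (to2 : action G T2)
    : Prop :=
  exists2 f : T1 -> T2, bijective f &
    forall x, {in G, forall a, f (to1 x a) = to2 (f x) a}.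

Section Triv.
Variable T : finType.
Definition triv_act (x : T) (_ : gT) := x.
Lemma triv_is_action : is_action G triv_act.
Proof. by split=> // a x y. Qed.
Definition triv_action : action G T := Action triv_is_action.
End Triv.

Section Transport.
Variables (T : finType) (to : action G T).
Definition ord_act (i : 'I_#|T|) a := enum_rank (to (enum_val i) a).
Lemma ord_is_action : is_action G ord_act.
Proof.
split=> [a i j /enum_rank_inj/act_inj/enum_val_inj // | i a b Ga Gb].
by rewrite /ord_act enum_rankK actMin.
Qed.
Definition ord_action : action G 'I_#|T| := Action ord_is_action.
End Transport.

Section SumProd.
Variables (T1 T2 : finType) (to1 : action G T1) (to2 : action G T2).

Definition sum_act (u : T1 + T2) a : T1 + T2 :=
  match u with inl x => inl (to1 x a) | inr y => inr (to2 y a) end.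
Lemma sum_is_action : is_action G sum_act.
Proof.
split=> [a [x|x] [y|y] //= [/act_inj->] // | [x|x] a b Ga Gb];
  by rewrite /= actMin.
Qed.
Definition sum_action : action G (T1 + T2)%type := Action sum_is_action.

Definition prod_act (u : T1 * T2) a : T1 * T2 := (to1 u.1 a, to2 u.2 a).
Lemma prod_is_action : is_action G prod_act.
Proof.
split=> [a [x1 x2] [y1 y2] [/= /act_inj-> /act_inj->] // | [x y] a b Ga Gb].
by rewrite /prod_act /= !actMin.
Qed.
Definition prod_action : action G (T1 * T2)%type := Action prod_is_action.
End SumProd.

End GSetConstructions.

Section InflationDeflationSets.

Variables (gT : finGroupType) (G N : {group gT}) (nsNG : N <| G).

Section Inf.
Variables (T : finType) (to : action (G / N) T).
Definition inf_act (x : T) a := to x (coset N a).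
Lemma inf_is_action : is_action G inf_act.
Proof.
have nNG := normal_norm nsNG.
split=> [a x y /act_inj // | x a b Ga Gb].
by rewrite /inf_act morphM ?(subsetP nNG) // actMin ?mem_quotient.
Qed.
Definition inf_action : action G T := Action inf_is_action.
End Inf.

(* X^N as a G/N-set: c acts on N-fixed points as any representative does.     *)
Section Fix.
Variables (T : finType) (to : action G T).
Definition fix_type : finType := {x : T | x \in 'Fix_to(N)}.
Lemma fix_subproof : G / N \subset subact_dom (fun x => x \in 'Fix_to(N)) (to %% N).
Proof.
have nNG := normal_norm nsNG; have sNG := normal_sub nsNG.
apply/subsetP=> c /morphimP[a Na Ga ->].
have Da : coset N a \in (G / N) by rewrite mem_quotient.
rewrite inE Da inE; apply/subsetP=> x; rewrite [x \in [set _ | _]]inE => fx.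
rewrite !inE /= modactE //; last by rewrite (setIidPr sNG).
apply/subsetP=> n Nn; rewrite inE -actMin ?(subsetP sNG n Nn) //.
have: n ^ a^-1 \in N by rewrite memJ_norm ?groupV.
move=> Nn'; rewrite (_ : a * n = (n ^ a^-1) * a)%g; last first.
  by rewrite conjgE invgK !mulgA mulgKV.
by rewrite actMin ?(subsetP sNG _ Nn') // (afixP fx _ Nn').
Qed.
Definition fix_action : action (G / N) fix_type := 
  (subaction fix_type (to %% N) \ fix_subproof)%act.
End Fix.

End InflationDeflationSets.

Section Marks.

Variables (gT : finGroupType) (G : {group gT}).

Lemma fix_iso (T1 T2 : finType) (to1 : action G T1) (to2 : action G T2) :
  gset_iso to1 to2 -> 
  forall H : {group gT}, H \subset G -> #|'Fix_to1(H)| = #|'Fix_to2(H)|.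
Proof.
case=> f bij_f eqf H sHG; rewrite -(card_imset _ (bij_inj bij_f)).
congr #|pred_of_set _|; apply/setP=> y; have [g fK gK] := bij_f.
rewrite -[y]gK mem_imset; last exact: bij_inj.
apply/afixP/afixP=> fx a Ha.
  by rewrite -eqf ?fx ?(subsetP sHG).
by apply: (can_inj fK); rewrite eqf ?fx ?(subsetP sHG).
Qed.

Section Iso.
Variables (T1 T2 : finType) (to1 : action G T1) (to2 : action G T2).

Let stab (T : finType) (to : action G T) x := 'C_G[x | to].
Let ex (T : finType) (to : action G T) (S : {set T}) (H : {group gT}) :=
  #|[set x in S | stab to x == H]|.

Lemma stabP (T : finType) (to : action G T) x a : 
  a \in stab to x <-> a \in G /\ to x a = x.
Proof.
rewrite /stab !inE; split; first by case/and3P=> Ga _; rewrite sub1set inE => /eqP.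
by case=> Ga fx; rewrite Ga sub1set inE fx eqxx.
Qed.

Lemma exP (eq_fix : forall H : {group gT}, H \subset G ->
    #|'Fix_to1(H)| = #|'Fix_to2(H)|) (H : {group gT}) :
  ex to1 setT H = ex to2 setT H.
Proof.
have sub (T : finType) (to : action G T) (K : {group gT}) x : K \subset G ->
    (x \in 'Fix_to(K)) = (K \subset stab to x).
  move=> sKG; apply/afixP/subsetP=> h a Ka; first by apply/stabP; rewrite h ?(subsetP sKG).
  by case/stabP: (h a Ka).
have [n] := ubnP (#|G| - #|H|)%N; elim: n H => // n IHn H ltn.
have ex0 (T : finType) (to : action G T) (K : {group gT}) : ~~ (K \subset G) -> ex to setT K = 0%N.
  move=> nsKG; apply/eqP; rewrite cards_eq0; apply/eqP/setP=> x; rewrite !inE.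
  by apply: contraNF nsKG => /eqP<-; apply: subsetIl.
have [sHG|nsHG] := boolP (H \subset G); last by rewrite !ex0.
have dec (T : finType) (to : action G T) : 
   #|'Fix_to(H)| = (ex to setT H + \sum_(K : {group gT} | H \proper K) ex to setT K)%N.
  have: forall x, (x \in 'Fix_to(H)) = (H \subset stab to x) by move=> x; apply: sub.
  move: 'Fix_to(H) => F FP.
  rewrite -sum1_card (partition_big (fun x => 'C_G[x | to]%G) (fun K : {group gT} => H \subset K)) /=; last first.
    by move=> x; rewrite FP.
  rewrite (bigD1 H) //=; congr (_ + _)%N.
    rewrite sum1dep_card; apply: eq_card => x; rewrite !inE FP.
    by rewrite -val_eqE /= /stab; apply/andP/eqP => [[_ /eqP]|->].
  apply: eq_big => [K|K /andP[sHK _]].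
    by rewrite properEneq andbC eq_sym.
  rewrite sum1dep_card; apply: eq_card => x; rewrite !inE FP.
  by rewrite -val_eqE /= /stab; apply/andP/eqP => [[_ /eqP]|->]; rewrite ?sHK ?eqxx.
have := eq_fix H sHG; rewrite !dec.
rewrite (eq_bigr (fun K => ex to2 setT K)); first by move/addIn.
move=> K ltHK; have [sKG|nsKG] := boolP (K \subset G); last by rewrite !ex0.
apply: IHn.
have := proper_card ltHK; have := subset_leq_card sKG; move: ltn; lia.
Qed.

Lemma exD (T : finType) (to : action G T) (S O : {set T}) H : O \subset S ->
  ex to S H = (ex to O H + ex to (S :\: O) H)%N.
Proof.
move=> sOS; rewrite /ex -(cardsID O [set x in S | stab to x == H]).
congr (_ + _)%N; apply: eq_card => x; rewrite !inE.
  by have [/(subsetP sOS)->|] := boolP (x \in O); rewrite ?andbF ?andbT.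
by rewrite andbA.
Qed.

Lemma match_gsets (y0 : T2) n (S1 : {set T1}) (S2 : {set T2}) :
  (#|S1| < n)%N ->
  {in S1, forall x, {in G, forall a, to1 x a \in S1}} ->
  {in S2, forall x, {in G, forall a, to2 x a \in S2}} ->
  (forall H : {group gT}, ex to1 S1 H = ex to2 S2 H) ->
  exists f : T1 -> T2, [/\ {in S1 &, injective f}, f @: S1 = S2 &
    {in S1, forall x, {in G, forall a, f (to1 x a) = to2 (f x) a}}].
Proof.
elim: n S1 S2 => // n IHn S1 S2 leS1 st1 st2 eqex.
have [S1_0|[x S1x]] := set_0Vmem S1.
  exists (fun=> y0); rewrite S1_0 imset0; split=> [x y|  |x]; rewrite ?inE //.
  apply/esym/eqP; rewrite -subset0; apply/subsetP=> y S2y.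
  have := eqex 'C_G[y | to2]%G; rewrite /ex S1_0 => /esym/eqP.
  rewrite (_ : [set _ in set0 | _] = set0); last by apply/setP=> z; rewrite !inE.
  by rewrite cards0 cards_eq0 => /eqP/setP/(_ y); rewrite !inE S2y eqxx.
have [y S2y stabxy] : exists2 y, y \in S2 & stab to2 y = stab to1 x.
  have: (0 < ex to1 S1 'C_G[x | to1]%G)%N.
    by apply/card_gt0P; exists x; rewrite inE S1x /=.
  by rewrite eqex => /card_gt0P[y]; rewrite inE => /andP[S2y /eqP]; exists y.
have eqst a b : a \in G -> b \in G -> (to1 x a == to1 x b) = (to2 y a == to2 y b).
  move=> Ga Gb.
  have aux (T : finType) (to : action G T) z : 
     (to z a == to z b) = (a * b^-1 \in stab to z).
    apply/eqP/idP=> [eqab|/stabP[_]].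
      apply/stabP; split; first by rewrite groupM ?groupV.
      by rewrite actMin ?groupV // eqab actKin.
    by rewrite actMin ?groupV // => {2}<-; rewrite actKVin.
  by rewrite !aux stabxy.
pose g z := if [pick a in G | to1 x a == z] is Some a then to2 y a else y0.
have gE a : a \in G -> g (to1 x a) = to2 y a.
  move=> Ga; rewrite /g; case: pickP => [b /andP[Gb]|/(_ a)]; last by rewrite Ga eqxx.
  by rewrite eqst // => /eqP.
pose O1 := orbit to1 G x; pose O2 := orbit to2 G y.
have sO1 : O1 \subset S1 by apply/subsetP=> _ /orbitP[a Ga <-]; apply: st1.
have sO2 : O2 \subset S2 by apply/subsetP=> _ /orbitP[a Ga <-]; apply: st2.
have stO (T : finType) (to : action G T) z w a : a \in G -> 
    (to w a \in orbit to G z) = (w \in orbit to G z).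
  move=> Ga; apply/orbitP/orbitP=> -[b Gb e]; last first.
    by exists (b * a); rewrite ?groupM // actMin // e.
  by exists (b * a^-1); rewrite ?groupM ?groupV // actMin ?groupV // e actKin.
have ginj : {in O1 &, injective g}.
  move=> _ _ /orbitP[a Ga <-] /orbitP[b Gb <-]; rewrite !gE // => /eqP.
  by rewrite -eqst // => /eqP.
have gim : g @: O1 = O2.
  apply/setP=> z; apply/imsetP/orbitP=> [[_ /orbitP[a Ga <-] ->]|[a Ga <-]].
    by exists a; rewrite // gE.
  by exists (to1 x a); rewrite ?gE // mem_orbit.
have gst : {in O1, forall z, stab to2 (g z) = stab to1 z}.
  move=> _ /orbitP[a Ga <-]; rewrite gE //; apply/setP=> b.
  apply/idP/idP=> /stabP[Gb] /eqP; rewrite -actMin // => e; apply/stabP; split=> //; 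
    apply/eqP; by rewrite -actMin // ?eqst ?groupM // -?eqst ?groupM.
have exO H : ex to1 O1 H = ex to2 O2 H.
  rewrite /ex -gim -(card_in_imset (f := g)); last first.
    by move=> u v /[!inE]/andP[Ou _] /andP[Ov _]; apply: ginj.
  apply: eq_card => z; apply/imsetP/idP.
    by case=> u /[!inE]/andP[Ou e] ->; rewrite imset_f //= gst.
  rewrite inE => /andP[/imsetP[u Ou ->] e]; exists u => //.
  by rewrite inE Ou -gst.
have [||||f [finj fim feq]] := IHn (S1 :\: O1) (S2 :\: O2).
- rewrite -ltnS; apply: leq_trans leS1; rewrite ltnS; apply: proper_card.
  apply/properP; split; first exact: subsetDl.
  by exists x; rewrite // inE orbit_refl.
- by move=> z /setDP[Sz Oz] a Ga; rewrite inE stO // Oz st1.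
- by move=> z /setDP[Sz Oz] a Ga; rewrite inE stO // Oz st2.
- by move=> H; have := eqex H; rewrite (exD _ _ sO1) (exD _ _ sO2) exO => /addnI.
have fO z : z \in S1 -> z \notin O1 -> f z \notin O2.
  move=> Sz Oz; have: f z \in S2 :\: O2 by rewrite -fim imset_f // inE Oz.
  by case/setDP.
have gO z : z \in O1 -> g z \in O2 by move=> Oz; rewrite -gim imset_f.
exists (fun z => if z \in O1 then g z else f z); split.
- move=> u v Su Sv; case: ifP => [Ou|/negbT Ou]; case: ifP => [Ov|/negbT Ov].
  + exact: ginj.
  + by move=> e; have := fO _ Sv Ov; rewrite -e gO.
  + by move=> e; have := fO _ Su Ou; rewrite e gO.
  + by apply: finj; rewrite inE ?Ou ?Ov.
- apply/setP=> z; apply/imsetP/idP=> [[u Su ->]|Sz].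
    case: ifP => [Ou|/negbT Ou]; first exact: (subsetP sO2) (gO _ Ou).
    have: f u \in S2 :\: O2 by rewrite -fim imset_f // inE Ou.
    by case/setDP.
  have [|Oz] := boolP (z \in O2).
    rewrite -gim => /imsetP[u Ou ->]; exists u; last by rewrite Ou.
    exact: (subsetP sO1).
  have: z \in S2 :\: O2 by rewrite inE Oz.
  rewrite -fim => /imsetP[u /setDP[Su Ou] ->]; exists u => //.
  by rewrite (negbTE Ou).
move=> z Sz a Ga; rewrite stO //; case: ifP => [/orbitP[b Gb <-]|/negbT Oz].
  by rewrite -actMin // !gE ?groupM // actMin.
by rewrite feq // inE Oz.
Qed.

Lemma iso_fix : (forall H : {group gT}, H \subset G ->
    #|'Fix_to1(H)| = #|'Fix_to2(H)|) -> gset_iso to1 to2.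
Proof.
move=> eqfix.
have cardT : #|T1| = #|T2|.
  have := eqfix 1%G (sub1G _).
  have fix1 (T : finType) (to : action G T) : 'Fix_to(1) = setT.
    by apply/setP=> x; rewrite in_setT; apply/afixP=> a /set1P->; rewrite act1.
  by rewrite !fix1 !cardsT.
have [y0 _|T2_0] := pickP (@predT T2); last first.
  have T1_0 : T1 -> False.
    move=> x; have: (0 < #|T1|)%N by apply/card_gt0P; exists x.
    by rewrite cardT (eq_card0 T2_0).
  have T2_F : T2 -> False by move=> y; have := T2_0 y.
  exists (fun x => match T1_0 x with end) => [|x]; last by case: (T1_0 x).
  by exists (fun y => match T2_F y with end) => z; [case: (T1_0 z) | case: (T2_F z)].
have [||||f [finj _ feq]] := @match_gsets y0 #|[set: T1]|.+1 setT setT => //;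
  try by move=> x _ a _; rewrite in_setT.
  by move=> H; apply: (exP eqfix).
exists f => [|x a Ga]; last by rewrite feq.
by apply: inj_card_bij; rewrite ?cardT // => x y /finj; apply.
Qed.

End Iso.
End Marks.

Section FixLemmas.

Variables (gT : finGroupType) (G : {group gT}).

Lemma fix_sum (T1 T2 : finType) (to1 : action G T1) (to2 : action G T2)
    (H : {group gT}) :
  #|'Fix_(sum_action to1 to2)(H)| = (#|'Fix_to1(H)| + #|'Fix_to2(H)|)%N.
Proof.
rewrite -!sum1_card big_sumType /=; congr (_ + _)%N; apply: eq_bigl => x.
  by apply/afixP/afixP=> fx a Ha; have := fx a Ha; [case | rewrite /= => ->].
by apply/afixP/afixP=> fx a Ha; have := fx a Ha; [case | rewrite /= => ->].
Qed.

Lemma fix_prod (T1 T2 : finType) (to1 : action G T1) (to2 : action G T2)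
    (H : {group gT}) :
  #|'Fix_(prod_action to1 to2)(H)| = (#|'Fix_to1(H)| * #|'Fix_to2(H)|)%N.
Proof.
rewrite -cardsX; apply: eq_card => -[x y]; rewrite in_setX.
apply/afixP/andP=> [fx|[/afixP fx /afixP fy] a Ha].
  by split; apply/afixP=> a Ha; case: (fx a Ha).
by rewrite /= /prod_act /= fx ?fy.
Qed.

Lemma fix_triv (T : finType) (H : {group gT}) :
  #|'Fix_(triv_action G T)(H)| = #|T|.
Proof. by rewrite -cardsT; apply: eq_card => x; rewrite in_setT; apply/afixP. Qed.

Lemma iso_ord (T : finType) (to : action G T) : gset_iso to (ord_action to).
Proof.
exists enum_rank => [|x a Ga]; first by exists enum_val; [apply: enum_rankK | apply: enum_valK].
by rewrite /= /ord_act enum_rankK.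
Qed.

Variables (N : {group gT}) (nsNG : N <| G).

Lemma fix_inf (T : finType) (to : action (G / N) T) (H : {group gT}) :
  H \subset G -> #|'Fix_(inf_action nsNG to)(H)| = #|'Fix_to(H / N)|.
Proof.
move=> sHG; have nNG := normal_norm nsNG.
apply: eq_card => x; apply/afixP/afixP=> fx a.
  by case/morphimP=> b Nb Hb ->; apply: fx.
by move=> Ha; apply: fx; rewrite mem_quotient.
Qed.

Lemma fix_fix (T : finType) (to : action G T) (Q : {group coset_of N}) :
  Q \subset G / N ->
  #|'Fix_(fix_action nsNG to)(Q)| = #|'Fix_to(coset N @*^-1 Q)|.
Proof.
move=> sQ; have nNG := normal_norm nsNG; have sNG := normal_sub nsNG.
have sPG : coset N @*^-1 Q \subset G.
  by rewrite -(quotientGK nsNG) morphpreS.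
have sNP : N \subset coset N @*^-1 Q by exact: sub_cosetpre.
have actE (x : fix_type N to) a : a \in G -> val (fix_action nsNG to x (coset N a)) = to (val x) a.
  move=> Ga; have fx := valP x.
  rewrite -[LHS]/(val (subact (to %% N) x (coset N a))) val_subact.
  rewrite (subsetP (fix_subproof nsNG to)) ?mem_quotient //= modactE ?(subsetP nNG) //.
  by rewrite (setIidPr sNG).
rewrite -(card_imset _ val_inj); apply: eq_card => x.
apply/imsetP/afixP=> [[y /afixP fy ->] a Pa|fx].
  rewrite -actE ?(subsetP sPG) // fy //.
  by case/morphpreP: Pa.
have fNx : x \in 'Fix_to(N) by apply/afixP=> a Na; apply: fx; apply: (subsetP sNP).
exists (Sub x fNx : fix_type N to) => //.
apply/afixP=> c Qc; have /morphimP[a Na Ga ca] := subsetP sQ c Qc.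
apply: val_inj; rewrite ca actE //= fx //.
by apply/morphpreP; rewrite -ca.
Qed.

End FixLemmas.

(* Grothendieck ring of finite G-sets.  A virtual G-set (X, Y) stands for     *)
(* [X] - [Y]; carriers are taken among the ordinals so that the G-sets form a *)
(* small type, and every finite G-set is isomorphic to one of these.          *)

Section Burnside.

Local Open Scope quotient_scope.

Variables (gT : finGroupType) (G : {group gT}).

Record gset := GSet { gset_card : nat; gset_act : action G 'I_gset_card }.

HB.instance Definition _ := gen_eqMixin gset.
HB.instance Definition _ := gen_choiceMixin gset.

Definition gset_of (T : finType) (to : action G T) := GSet (ord_action to).
Definition gsum X Y := gset_of (sum_action (gset_act X) (gset_act Y)).
Definition gprod X Y := gset_of (prod_action (gset_act X) (gset_act Y)).
Definition gempty := gset_of (triv_action G void).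
Definition gpoint := gset_of (triv_action G unit).

Definition vgset := (gset * gset)%type.
HB.instance Definition _ := Choice.on vgset.

Definition veq (p q : vgset) : bool :=
  `[< exists Z, gset_iso (gset_act (gsum (gsum p.1 q.2) Z))
                         (gset_act (gsum (gsum q.1 p.2) Z)) >].

Local Open Scope ring_scope.

Definition gmark (X : gset) (H : {group gT}) : nat := #|'Fix_(gset_act X)(H)|.
Definition vmark (p : vgset) H : int := (gmark p.1 H)%:Z - (gmark p.2 H)%:Z.

Lemma gmark_of (T : finType) (to : action G T) (H : {group gT}) : H \subset G ->
  gmark (gset_of to) H = #|'Fix_to(H)|.
Proof. by move=> sHG; rewrite (fix_iso (iso_ord to)). Qed.

Lemma gmark_sum X Y (H : {group gT}) : H \subset G ->
  gmark (gsum X Y) H = (gmark X H + gmark Y H)%N.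
Proof. by move=> sHG; rewrite gmark_of // fix_sum. Qed.

Lemma gmark_prod X Y (H : {group gT}) : H \subset G ->
  gmark (gprod X Y) H = (gmark X H * gmark Y H)%N.
Proof. by move=> sHG; rewrite gmark_of // fix_prod. Qed.

Lemma gmark_empty (H : {group gT}) : H \subset G -> gmark gempty H = 0%N.
Proof. by move=> sHG; rewrite gmark_of // fix_triv card_void. Qed.

Lemma gmark_point (H : {group gT}) : H \subset G -> gmark gpoint H = 1%N.
Proof. by move=> sHG; rewrite gmark_of // fix_triv card_unit. Qed.

Lemma veqP p q :
  reflect (forall H : {group gT}, H \subset G -> vmark p H = vmark q H) (veq p q).
Proof.
rewrite /veq; apply: (iffP (asboolP _)) => [[Z isoZ] H sHG|eqm].
  have := fix_iso isoZ sHG; rewrite -!/(gmark _ _) !gmark_sum //.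
  rewrite /vmark; lia.
exists gempty; apply: iso_fix => H sHG; rewrite -!/(gmark _ _) !gmark_sum //.
have := eqm H sHG; rewrite /vmark; lia.
Qed.

Lemma veq_refl : reflexive veq. Proof. by move=> p; apply/veqP. Qed.
Lemma veq_sym : symmetric veq.
Proof. by move=> p q; apply/veqP/veqP=> e H sHG; rewrite e. Qed.
Lemma veq_trans : transitive veq.
Proof. by move=> q p r /veqP e /veqP e'; apply/veqP=> H sHG; rewrite e // e'. Qed.

Canonical veq_equiv := EquivRel veq veq_refl veq_sym veq_trans.

Definition burnside := {eq_quot veq_equiv}.
HB.instance Definition _ := Choice.on burnside.
HB.instance Definition _ := EqQuotient.on burnside.

Definition vclass (p : vgset) : burnside := \pi_burnside p.
Definition vrep (a : burnside) : vgset := generic_quotient.repr a.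

Definition bclass (T : finType) (to : action G T) : burnside :=
  vclass (gset_of to, gempty).

(* mark a H is |a^H|, for H a subgroup of G. *)
Definition mark (a : burnside) (H : {group gT}) : int := vmark (vrep a) H.

Lemma mark_pi p (H : {group gT}) : H \subset G -> mark (vclass p) H = vmark p H.
Proof.
by move=> sHG; rewrite /mark; have /eqmodP/veqP-> : vrep (vclass p) = p %[mod burnside] by rewrite reprK.
Qed.

Lemma mark_inj a b :
  (forall H : {group gT}, H \subset G -> mark a H = mark b H) -> a = b.
Proof. by move=> e; rewrite -[a]reprK -[b]reprK; apply/eqmodP/veqP; apply: e. Qed.

Definition badd (a b : burnside) : burnside :=
  vclass (gsum (vrep a).1 (vrep b).1, gsum (vrep a).2 (vrep b).2).
Definition bopp (a : burnside) : burnside := vclass ((vrep a).2, (vrep a).1).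
Definition bmul (a b : burnside) : burnside :=
  vclass (gsum (gprod (vrep a).1 (vrep b).1) (gprod (vrep a).2 (vrep b).2),
       gsum (gprod (vrep a).1 (vrep b).2) (gprod (vrep a).2 (vrep b).1)).
Definition bzero : burnside := vclass (gempty, gempty).
Definition bone : burnside := bclass (triv_action G unit).

Section MarkOps.
Variables (H : {group gT}) (sHG : H \subset G).
Lemma mark_badd a b : mark (badd a b) H = mark a H + mark b H.
Proof. rewrite mark_pi // /mark /vmark !gmark_sum //=; lia. Qed.
Lemma mark_bopp a : mark (bopp a) H = - mark a H.
Proof. rewrite mark_pi // /mark /vmark /=; lia. Qed.
Lemma mark_bmul a b : mark (bmul a b) H = mark a H * mark b H.
Proof. rewrite mark_pi // /mark /vmark !gmark_sum // !gmark_prod //=; lia. Qed.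
Lemma mark_bzero : mark bzero H = 0.
Proof. by rewrite mark_pi // /vmark subrr. Qed.
Lemma mark_bone : mark bone H = 1.
Proof. by rewrite mark_pi // /vmark gmark_point // gmark_empty. Qed.
Definition markE := (mark_badd, mark_bopp, mark_bmul, mark_bzero, mark_bone).
End MarkOps.

Fact baddA : associative badd.
Proof. by move=> a b c; apply: mark_inj => H sHG; rewrite !markE // addrA. Qed.
Fact baddC : commutative badd.
Proof. by move=> a b; apply: mark_inj => H sHG; rewrite !markE // addrC. Qed.
Fact badd0 : left_id bzero badd.
Proof. by move=> a; apply: mark_inj => H sHG; rewrite !markE // add0r. Qed.
Fact baddN : left_inverse bzero bopp badd.
Proof. by move=> a; apply: mark_inj => H sHG; rewrite !markE // addNr. Qed.
Fact bmulA : associative bmul.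
Proof. by move=> a b c; apply: mark_inj => H sHG; rewrite !markE // mulrA. Qed.
Fact bmulC : commutative bmul.
Proof. by move=> a b; apply: mark_inj => H sHG; rewrite !markE // mulrC. Qed.
Fact bmul1 : left_id bone bmul.
Proof. by move=> a; apply: mark_inj => H sHG; rewrite !markE // mul1r. Qed.
Fact bmulDl : left_distributive bmul badd.
Proof. by move=> a b c; apply: mark_inj => H sHG; rewrite !markE // mulrDl. Qed.
Fact bone_neq0 : bone != bzero.
Proof.
by apply/eqP=> /(congr1 (mark^~ G)); rewrite !markE.
Qed.

HB.instance Definition _ := GRing.isZmodule.Build burnside baddA baddC badd0 baddN.
HB.instance Definition _ :=
  GRing.Zmodule_isComNzRing.Build burnside bmulA bmulC bmul1 bmulDl bone_neq0.

Section MarkRing.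
Variables (H : {group gT}) (sHG : H \subset G).
Lemma markD a b : mark (a + b) H = mark a H + mark b H.
Proof. exact: mark_badd. Qed.
Lemma markN a : mark (- a) H = - mark a H.
Proof. exact: mark_bopp. Qed.
Lemma markM a b : mark (a * b) H = mark a H * mark b H.
Proof. exact: mark_bmul. Qed.
Lemma mark0 : mark 0 H = 0.
Proof. exact: mark_bzero. Qed.
Lemma mark1 : mark 1 H = 1.
Proof. exact: mark_bone. Qed.
Lemma mark_class (T : finType) (to : action G T) :
  mark (bclass to) H = #|'Fix_to(H)|%:Z.
Proof. by rewrite mark_pi // /vmark gmark_of // gmark_empty // subr0. Qed.
End MarkRing.

Lemma bclass_iso (T1 T2 : finType) (to1 : action G T1) (to2 : action G T2) :
  bclass to1 = bclass to2 <-> gset_iso to1 to2.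
Proof.
split=> [e|iso].
  apply: iso_fix => H sHG; have := congr1 (mark^~ H) e.
  by rewrite !mark_class // => -[].
by apply: mark_inj => H sHG; rewrite !mark_class // (fix_iso iso).
Qed.

(* In B(G) every unit is its own inverse. *)
Fact bunit_sqr (u v : burnside) : v * u = 1 -> u * u == 1.
Proof.
move=> uv1; apply/eqP/mark_inj => H sHG; rewrite markM // mark1 //.
have := congr1 (mark^~ H) uv1; rewrite markM // mark1 // => /eqP.
move: (mark u H) (mark v H) => x y /eqP e.
have : x \is a GRing.unit by apply/unitrP; exists y; split; rewrite // mulrC.
by case/orP=> /eqP->.
Qed.

Let bunitP (u : burnside) := u * u == 1.

Fact bmulV : {in bunitP, left_inverse 1 id (@GRing.mul burnside)}.
Proof. by move=> u /eqP. Qed.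
Fact bunitPl (u v : burnside) : v * u = 1 -> u \in bunitP.
Proof. exact: bunit_sqr. Qed.
Fact binv_out : {in [predC bunitP], (id : burnside -> burnside) =1 id}.
Proof. by []. Qed.

HB.instance Definition _ :=
  GRing.ComNzRing_hasMulInverse.Build burnside bmulV bunitPl binv_out.

Lemma burnside_sqr (u : burnside) : u \is a GRing.unit -> u * u = 1.
Proof. by move=> Uu; apply/eqP; apply: (@bunit_sqr u u^-1); rewrite mulVr. Qed.

Lemma mark_unit (u : burnside) (H : {group gT}) :
  u \is a GRing.unit -> H \subset G -> mark u H = 1 \/ mark u H = -1.
Proof.
move=> Uu sHG; have := congr1 (mark^~ H) (burnside_sqr Uu).
rewrite markM // mark1 // -expr2 => /eqP; rewrite sqrf_eq1.
by case/orP=> /eqP->; [left | right].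
Qed.

(* B^x(G), written additively so as to carry an F_2-vector space structure:   *)
(* u + v is the product of u and v in B(G), and 0 is the unit 1.              *)

Record bunits := BUnit { bunit_val : burnside; bunit_valP : bunit_val \is a GRing.unit }.

HB.instance Definition _ := [isSub for bunit_val].
HB.instance Definition _ := [Choice of bunits by <:].

Fact bunits_mul_proof (u v : bunits) : bunit_val u * bunit_val v \is a GRing.unit.
Proof. by rewrite unitrM !bunit_valP. Qed.
Definition buadd u v := BUnit (bunits_mul_proof u v).
Definition buzero := BUnit (unitr1 burnside).

Fact buaddA : associative buadd.
Proof. by move=> u v w; apply: val_inj; rewrite /= mulrA. Qed.
Fact buaddC : commutative buadd.
Proof. by move=> u v; apply: val_inj; rewrite /= mulrC. Qed.
Fact buadd0 : left_id buzero buadd.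
Proof. by move=> u; apply: val_inj; rewrite /= mul1r. Qed.
Fact buaddN : left_inverse buzero id buadd.
Proof. by move=> u; apply: val_inj; rewrite /= burnside_sqr ?bunit_valP. Qed.

HB.instance Definition _ := GRing.isZmodule.Build bunits buaddA buaddC buadd0 buaddN.

Lemma buaddxx (u : bunits) : u + u = 0.
Proof. exact: buaddN. Qed.

Definition buscale (c : 'F_2) (u : bunits) : bunits := u *+ (c : nat).

Lemma F2_cases (c : 'F_2) : c = 0 \/ c = 1.
Proof. by case: c => -[|[|//]] i; [left | right]; apply: val_inj. Qed.

Fact buscaleA a b v : buscale a (buscale b v) = buscale (a * b) v.
Proof.
by have [->|->] := F2_cases a; have [->|->] := F2_cases b;
  rewrite /buscale /= ?mulr0n ?mulr1n ?mul0rn.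
Qed.
Fact buscale1 : left_id 1 buscale. Proof. by []. Qed.
Fact buscaleDr : right_distributive buscale +%R.
Proof. by move=> a u v; rewrite /buscale mulrnDl. Qed.
Fact buscaleDl v : {morph buscale^~ v : a b / a + b}.
Proof.
by move=> a b; have [->|->] := F2_cases a; have [->|->] := F2_cases b;
  rewrite /buscale /= ?mulr0n ?mulr1n ?addr0 ?add0r ?buaddxx.
Qed.

HB.instance Definition _ :=
  GRing.Zmodule_isLmodule.Build 'F_2 bunits buscaleA buscale1 buscaleDr buscaleDl.

(* Finite dimension: the signs of the marks embed B^x(G) in a row space. *)
Let m := #|{: {group gT}}|.
Let sgrp (i : 'I_m) : {group gT} := enum_val i.
Let sgn (u : bunits) : 'rV['F_2]_m :=
  \row_i ((sgrp i \subset G) && (mark (val u) (sgrp i) != 1))%:R.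

Fact sgn_linear : linear sgn.
Proof.
have sgnD u v : sgn (u + v) = sgn u + sgn v.
  apply/rowP=> i; rewrite !mxE; case: (boolP (sgrp i \subset G)) => sHG; last first.
    by rewrite addr0.
  rewrite markM //=; have [->|->] := mark_unit (bunit_valP u) sHG;
    have [->|->] := mark_unit (bunit_valP v) sHG; by apply: val_inj.
move=> c u v; rewrite sgnD; have [->|->] := F2_cases c; last by rewrite !scale1r.
rewrite !scale0r; congr (_ + _); apply/rowP=> i; rewrite !mxE.
by case: (boolP (sgrp i \subset G)) => sHG //=; rewrite mark1 ?eqxx.
Qed.

HB.instance Definition _ := GRing.isLinear.Build 'F_2 bunits 'rV['F_2]_m _ sgn sgn_linear.

Fact sgn_inj : injective sgn.
Proof.
move=> u v /rowP e; apply: val_inj; apply: mark_inj => H sHG.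
have := e (enum_rank H); rewrite !mxE /sgrp enum_rankK sHG /=.
by have [->|->] := mark_unit (bunit_valP u) sHG;
   have [->|->] := mark_unit (bunit_valP v) sHG => // /eqP.
Qed.

Let sgn_im : {vspace 'rV['F_2]_m} :=
  <<[seq w <- enum 'rV['F_2]_m | `[< exists u, sgn u = w >]]>>%VS.

Fact sgn_imP w : reflect (exists u, sgn u = w) (w \in sgn_im).
Proof.
apply: (iffP idP) => [|[u <-]]; last first.
  apply: memv_span; rewrite mem_filter mem_enum andbT.
  by apply/asboolP; exists u.
rewrite /sgn_im; set X := filter _ _ => /(@coord_span _ _ _ (in_tuple X)) ->.
apply: (big_ind (fun w => exists u, sgn u = w)) => [|_ _ [u <-] [v <-]|i _].
- by exists 0; rewrite linear0.
- by exists (u + v); rewrite linearD.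
have: X`_i \in X by apply: mem_nth; rewrite ltn_ord.
rewrite {2}/X mem_filter => /andP[/asboolP[u <-] _].
by eexists (_ *: u); rewrite linearZ.
Qed.

Let bucoord (u : bunits) : 'rV['F_2]_(\dim sgn_im) :=
  \row_i coord (vbasis sgn_im) i (sgn u).

Fact bucoord_linear : linear bucoord.
Proof. by move=> c u v; apply/rowP=> i; rewrite !mxE !linearP. Qed.

Fact bucoord_bij : bijective bucoord.
Proof.
have uP r : exists u, bucoord u = r.
  have /sgn_imP[u eu] : \sum_i r 0 i *: (vbasis sgn_im)`_i \in sgn_im.
    by apply: memv_suml => i _; apply: memvZ; apply: vbasis_mem; rewrite mem_nth ?size_tuple.
  exists u; apply/rowP=> i; rewrite mxE eu coord_sum_free //.
  exact: basis_free (vbasisP _).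
have [g gK] := choice uP; exists g => // u.
apply: sgn_inj.
have im v : sgn v \in sgn_im by apply/sgn_imP; exists v.
rewrite (coord_vbasis (im (g (bucoord u)))) (coord_vbasis (im u)).
apply: eq_bigr => i _; congr (_ *: _).
by have /rowP/(_ i) := gK (bucoord u); rewrite !mxE.
Qed.

HB.instance Definition _ := Lmodule_hasFinDim.Build 'F_2 bunits
  (exist2 _ _ bucoord bucoord_linear bucoord_bij).

End Burnside.

Notation "''B' ( G )" := (burnside G) (at level 8, format "''B' ( G )") : type_scope.
Notation "''Bx' ( G )" := (bunits G) (at level 8, format "''Bx' ( G )") : type_scope.

Section UnitMap.

Local Open Scope ring_scope.
Variables (gT hT : finGroupType) (G : {group gT}) (K : {group hT}).
Variable f : {rmorphism 'B(G) -> 'B(K)}.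

Definition bumap (u : 'Bx(G)) : 'Bx(K) := BUnit (rmorph_unit f (bunit_valP u)).

Fact bumap_linear : linear bumap.
Proof.
have fD u v : bumap (u + v) = bumap u + bumap v.
  by apply: val_inj; rewrite /= rmorphM.
move=> c u v; rewrite fD; have [->|->] := F2_cases c; last by rewrite !scale1r.
by rewrite !scale0r; congr (_ + _); apply: val_inj; rewrite /= rmorph1.
Qed.

HB.instance Definition _ :=
  GRing.isLinear.Build 'F_2 'Bx(G) 'Bx(K) _ bumap bumap_linear.

End UnitMap.

Section InflationDeflation.

Local Open Scope ring_scope.
Variables (gT : finGroupType) (G N : {group gT}) (nsNG : N <| G).
Local Notation Q := (G / N)%G.

Definition binf (a : 'B(Q)) : 'B(G) :=
  bclass (inf_action nsNG (gset_act (vrep a).1)) -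
  bclass (inf_action nsNG (gset_act (vrep a).2)).

Definition bdefl (a : 'B(G)) : 'B(Q) :=
  bclass (fix_action nsNG (gset_act (vrep a).1) : action Q _) -
  bclass (fix_action nsNG (gset_act (vrep a).2) : action Q _).

Lemma mark_binf a (H : {group gT}) : H \subset G ->
  mark (binf a) H = mark a (H / N)%G.
Proof. by move=> sHG; rewrite markD // markN // !mark_class // !fix_inf. Qed.

Lemma mark_bdefl a (H : {group coset_of N}) : H \subset Q ->
  mark (bdefl a) H = mark a (coset N @*^-1 H)%G.
Proof. by move=> sHQ; rewrite markD // markN // !mark_class // !fix_fix. Qed.

Let sub_preim (H : {group coset_of N}) : H \subset Q -> coset N @*^-1 H \subset G.
Proof. by move=> sHQ; rewrite -(quotientGK nsNG) morphpreS. Qed.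

Lemma binf_class (T : finType) (to : action Q T) :
  binf (bclass to) = bclass (inf_action nsNG to).
Proof.
apply: mark_inj => H sHG.
by rewrite mark_binf // !mark_class ?quotientS // fix_inf.
Qed.

Lemma bdefl_class (T : finType) (to : action G T) :
  bdefl (bclass to) = bclass (fix_action nsNG to : action Q _).
Proof.
apply: mark_inj => H sHQ.
by rewrite mark_bdefl // !mark_class ?sub_preim // fix_fix.
Qed.

Fact binf_is_zmod : zmod_morphism binf.
Proof.
move=> a b; apply: mark_inj => H sHG; have sHQ := quotientS N sHG.
by rewrite !(mark_binf, markD, markN) // !(markD, markN).
Qed.
Fact binf_is_monoid : monoid_morphism binf.
Proof.
split=> [|a b]; apply: mark_inj => H sHG; have sHQ := quotientS N sHG.
  by rewrite mark_binf // !mark1.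
by rewrite !(mark_binf, markM) // !markM.
Qed.
Fact bdefl_is_zmod : zmod_morphism bdefl.
Proof.
move=> a b; apply: mark_inj => H sHQ; have sHG := sub_preim sHQ.
by rewrite !(mark_bdefl, markD, markN) // !(markD, markN).
Qed.
Fact bdefl_is_monoid : monoid_morphism bdefl.
Proof.
split=> [|a b]; apply: mark_inj => H sHQ; have sHG := sub_preim sHQ.
  by rewrite mark_bdefl // !mark1.
by rewrite !(mark_bdefl, markM) // !markM.
Qed.

HB.instance Definition _ := GRing.isZmodMorphism.Build 'B(Q) 'B(G) binf binf_is_zmod.
HB.instance Definition _ := GRing.isMonoidMorphism.Build 'B(Q) 'B(G) binf binf_is_monoid.
HB.instance Definition _ := GRing.isZmodMorphism.Build 'B(G) 'B(Q) bdefl bdefl_is_zmod.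
HB.instance Definition _ := GRing.isMonoidMorphism.Build 'B(G) 'B(Q) bdefl bdefl_is_monoid.

Definition binfx : 'Bx(Q) -> 'Bx(G) := bumap binf.
Definition bdeflx : 'Bx(G) -> 'Bx(Q) := bumap bdefl.

HB.instance Definition _ := GRing.Linear.on binfx.
HB.instance Definition _ := GRing.Linear.on bdeflx.

End InflationDeflation.

Section Faithful.

Variables (gT : finGroupType) (G : {group gT}).

Definition bfaithful : {vspace 'Bx(G)} :=
  (\bigcap_(N : {N : {group gT} | N <| G} | val N :!=: 1)
     lker (linfun (bdeflx (valP N))))%VS.

Lemma bfaithfulP (u : 'Bx(G)) :
  reflect (forall N K : {group gT}, N <| G -> N :!=: 1 -> N \subset K ->
             K \subset G -> mark (val u) K = 1%R)
          (u \in bfaithful).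
Proof.
rewrite memvE; apply: (iffP subv_bigcapP) => [fu N K nsNG ntN sNK sKG | fu N ntN].
  have := fu (exist _ N nsNG) ntN; rewrite -memvE memv_ker lfunE => /eqP.
  move/(congr1 (fun v => mark (val v) (K / N)%G)) => /=.
  rewrite mark_bdefl ?quotientS // mark1 ?quotientS // => <-.
  congr (mark _ _); apply: val_inj => /=.
  by rewrite quotientGK // (normalS sNK sKG nsNG).
rewrite -memvE memv_ker lfunE; apply/eqP/val_inj/mark_inj => K sK /=.
rewrite mark_bdefl // mark1 //; apply: (fu (val N)) => //; first exact: (valP N).
  exact: sub_cosetpre.
by apply: subset_trans (morphpreS _ sK) _; rewrite quotientGK ?(valP N).
Qed.

(* When the group of faithful units has order 2, vpick returns its unique     *)
(* non-identity element.                                                      *)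
Definition Phi : 'Bx(G) := vpick bfaithful.

Definition pseudodihedral : bool :=
  [exists N : {group gT}, exists T : {group gT},
    [&& N ><| T == G, abelian N, (2 < #|N|)%N,
        [forall P : {group gT}, 2.-Sylow(N) P ==> cyclic P],
        T \isog Zp 2 & [forall t in T^#, forall x in N, x ^ t == x^-1]]].

End Faithful.

Section Basis.

Variables (gT : finGroupType) (G : {group gT}).

Definition calN : {set {group gT}} :=
  [set N : {group gT} | (N <| G) &&
     [|| G / N :==: 1, G / N \isog Zp 2 | pseudodihedral (G / N)%G]].

Lemma calN_normal N : N \in calN -> N <| G.
Proof. by rewrite inE => /andP[]. Qed.

Definition inf_Phi (N : {N : {group gT} | N \in calN}) : 'Bx(G) :=
  binfx (calN_normal (valP N)) (Phi (G / val N)%G).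

End Basis.

(* Main.v *)
Require Import Defs.
From mathcomp Require Import all_boot all_algebra all_fingroup all_solvable.
From mathcomp Require Import zify.

(* A unit is determined by its signs at the subgroups of [G], and sorting      *)
(* these signs by the normal subgroups on which the unit deflates trivially    *)
(* reduces the theorem to computing the faithful units of the quotients of     *)
(* [G].  By the Frobenius-Cauchy formula, for a subgroup [H] normalising [K],  *)
(* [#|H|] divides twice the number of [h] in [H] with sign [-1] at [<h> K].    *)
(* A faithful unit has sign [1] at every subgroup containing a nontrivial      *)
(* normal one, so if it is nontrivial, then [#|'Z(G)| <= 2].  This settles     *)
(* abelian groups.  If [A] is abelian of index 2 and [t] lies outside [A],     *)
(* then [a * a ^ t] is central for [a] in [A], so that [t] inverts [A] up to a *)
(* central involution; counting signs over [A] and over [G] leaves only        *)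
(* pseudodihedral groups.  In a pseudodihedral group [A ><| <[t]>] the same    *)
(* counts force the sign [-1] exactly at the subgroups [<[g]>] with [g]        *)
(* outside [A]; these signs are those of [1 - G/<t> - G/<s> + G/1], where [t]  *)
(* and [s] represent the [A]-classes outside [A] ([s = t] when there is only   *)
(* one).                                                                       *)

(** The inflated units form a triangular system: by [mark_inf_Phi1], [inf_Phi N] has sign 1 at every
    subgroup containing a normal subgroup of [G] that is not inside [N]. Looking only above a normal
    subgroup of largest order isolates one term of a relation, whence independence
    ([inf_Phi_indep]). For spanning ([inf_Phi_span]), choose [N] of largest order such that [u]
    deflates nontrivially to [G / N]; the deflation is then faithful, and adding its inflation to
    [u] leaves fewer nontrivial deflations. The hypothesis passes to quotients, so everything rests
    on faithful units: nontrivial ones occur only in the three listed types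
    ([faithful_classification]), where exactly one exists ([Phi_neq0], [Phi_uniq]). The
    classification, and uniqueness in the pseudodihedral case, come from the congruence
    [dvd_card_neg], which bounds from below how often the sign -1 occurs. *)

Set Implicit Arguments.
Unset Strict Implicit.
Unset Printing Implicit Defensive.

Import GRing.Theory Num.Theory.

(** * Signs of faithful units *)

Section FaithfulUnits.

Local Open Scope group_scope.

Implicit Types gT : finGroupType.

(** [H] normalises [K], hence acts on the [K]-fixed points, and [h] fixes those that are fixed by
    [<[h]> <*> K]. The sum is thus [#|H|] times a number of orbits. *)
Lemma dvd_sum_fix gT (G H K : {group gT}) (T : finType) (to : action G T) :
    H \subset G -> K \subset G -> H \subset 'N(K) ->
  #|H| %| \sum_(h in H) #|'Fix_to(<[h]> <*> K)|.
Proof.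
move=> sHG sKG nKH.
have acts_fix : [acts H, on 'Fix_to(K) | to].
  apply/subsetP=> h Hh; have Gh := subsetP sHG h Hh.
  rewrite !inE Gh; apply/subsetP=> x /afixP fx; rewrite inE; apply/afixP=> k Kk.
  have Kk' : k ^ h^-1 \in K by rewrite memJ_norm ?groupV ?(subsetP nKH).
  have -> : to (to x h) k = to (to x (k ^ h^-1)) h.
    by rewrite -!actMin ?(subsetP sKG k) ?(subsetP sKG _ Kk') // conjgE invgK mulgA mulgKV.
  by rewrite fx.
have := Frobenius_Cauchy acts_fix.
under eq_bigr => h Hh.
  have Gh := subsetP sHG h Hh.
  rewrite setIC -(afix_cycle_in to Gh) -afixU -(afix_gen_in to); last first.
    by rewrite subUset sKG cycle_subG Gh.
  over.
by move=> ->; rewrite dvdn_mull.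
Qed.

Lemma mark_neq1 gT (G K : {group gT}) (u : 'Bx(G)) :
  K \subset G -> mark (val u) K != 1%R -> mark (val u) K = (- 1)%R.
Proof. by move=> sKG; case: (mark_unit (bunit_valP u) sKG) => ->. Qed.

(** A unit is a difference of two G-sets, so [#|H|] divides the sum of its marks at the [<[h]> <*>
    K]. These marks are signs, with sum [#|H| - #|D|.*2]. *)
Lemma dvd_card_neg gT (G H K : {group gT}) (u : 'Bx(G)) :
    H \subset G -> K \subset G -> H \subset 'N(K) ->
  #|H| %| #|[set h in H | mark (val u) (<[h]> <*> K)%G != 1%R]|.*2.
Proof.
move=> sHG sKG nKH; set D := [set h in H | _].
have sub h : h \in H -> <[h]> <*> K \subset G.
  by move=> Hh; rewrite join_subG sKG cycle_subG (subsetP sHG).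
have /dvdnP[m1 e1] := dvd_sum_fix (gset_act (vrep (val u)).1) sHG sKG nKH.
have /dvdnP[m2 e2] := dvd_sum_fix (gset_act (vrep (val u)).2) sHG sKG nKH.
have eS : (\sum_(h in H) mark (val u) (<[h]> <*> K)%G = #|H|%:Z - #|D|.*2%:Z)%R.
  rewrite (big_setID D) /=.
  rewrite (eq_bigr (fun=> (- 1)%R)); last first.
    by move=> h /setIP[Hh]; rewrite inE Hh => /mark_neq1; apply; apply: sub.
  rewrite [X in (_ + X)%R](eq_bigr (fun=> 1%R)); last first.
    by move=> h /setDP[Hh]; rewrite inE Hh negbK => /eqP.
  rewrite !sumr_const mulNrn !natz; have := cardsID D H.
  rewrite (setIidPr _); first last; first (by apply/subsetP=> h /[!inE]/andP[]).
  by move=> <-; rewrite -addnn !PoszD opprD addrA [(_ + _ - _)%R]addrC addrA addKr addrC.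
have : (\sum_(h in H) mark (val u) (<[h]> <*> K)%G
        = (m1 * #|H|)%N%:Z - (m2 * #|H|)%N%:Z)%R.
  by rewrite -e1 -e2 !(big_morph Posz PoszD (erefl _)) -sumrB.
rewrite eS => e; rewrite -(@dvdn_addr (m1 * #|H|)) ?dvdn_mull //.
rewrite (_ : _ + _ = m2.+1 * #|H|)%N ?dvdn_mull //.
by move: e; lia.
Qed.

Lemma bunits0P gT (G : {group gT}) (u : 'Bx(G)) :
  reflect (forall K : {group gT}, K \subset G -> mark (val u) K = 1%R) (u == 0%R).
Proof.
apply: (iffP eqP) => [-> K sKG|u1]; first by rewrite mark1.
by apply/val_inj/mark_inj => K sKG; rewrite u1 // mark1.
Qed.

Lemma faithful_core gT (G : {group gT}) (u : 'Bx(G)) (K N : {group gT}) :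
  u \in bfaithful G -> K \subset G -> mark (val u) K != 1%R ->
  N <| G -> N \subset K -> N :=: 1.
Proof.
move=> /bfaithfulP fu sKG uK nsNG sNK; apply/eqP/negPn/negP => ntN.
by move/eqP: uK; apply; apply: fu sNK sKG.
Qed.

Lemma bunits_neq0P gT (G : {group gT}) (u : 'Bx(G)) : u != 0%R ->
  exists2 K : {group gT}, K \subset G & mark (val u) K != 1%R.
Proof.
move=> ntu; have [/existsP[K /andP[]]|] :=
  boolP [exists K : {group gT}, (K \subset G) && (mark (val u) K != 1%R)].
  by exists K.
rewrite negb_exists => /forallP u1; case/bunits0P: ntu => K sKG.
by have := u1 K; rewrite sKG negbK => /eqP.
Qed.

Lemma dvd_card_neg1 gT (G H : {group gT}) (u : 'Bx(G)) : H \subset G ->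
  #|H| %| #|[set h in H | mark (val u) <[h]>%G != 1%R]|.*2.
Proof.
move=> sHG; have := dvd_card_neg u sHG (sub1G G) (norms1 _).
rewrite (_ : [set _ in _ | _] = [set h in H | mark (val u) <[h]>%G != 1%R]) //.
apply/setP=> h; rewrite !inE; congr (_ && (mark _ _ != _)).
by apply: group_inj; rewrite /= joingG1.
Qed.

(** Fix [K] with sign -1. For central [z], the normal subgroup [<[z]>] lies in [<[z]> <*> K], so the
    sign there is -1 only for [z = 1]; counting over the centre shows that its order divides 2. *)
Lemma faithful_card_center gT (G : {group gT}) (u : 'Bx(G)) :
  u \in bfaithful G -> u != 0%R -> #|'Z(G)| <= 2.
Proof.
move=> fu /bunits_neq0P[K sKG uK].
have sZG := center_sub G.
have nKZ : 'Z(G) \subset 'N(K).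
  exact: subset_trans (subsetIr _ _) (subset_trans (centS sKG) (cent_sub K)).
have := dvd_card_neg u sZG sKG nKZ; set D := [set _ in _ | _].
suff -> : D = [set 1] by rewrite cards1 => /dvdn_leq; apply.
apply/setP=> z; rewrite in_set1 inE; apply/andP/eqP => [[Zz uz]|->]; last first.
  by rewrite group1 (_ : (<[1]> <*> K)%G = K) //; apply: group_inj; rewrite /= cycle1 joing1G.
have nsz : <[z]> <| G by apply: sub_center_normal; rewrite cycle_subG.
have sz : <[z]> <*> K \subset G by rewrite join_subG sKG (normal_sub nsz).
by apply/eqP; rewrite -cycle_eq1; apply/eqP/(faithful_core fu sz uz nsz)/joing_subl.
Qed.

Lemma faithful_abelian gT (G : {group gT}) (u : 'Bx(G)) :
  abelian G -> u \in bfaithful G -> u != 0%R -> #|G| <= 2.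
Proof. by move=> abG fu /(faithful_card_center fu); rewrite (center_idP abG). Qed.

End FaithfulUnits.

(** * Groups with a subgroup of index 2 *)

Section IndexTwo.

Local Open Scope group_scope.

Variables (gT : finGroupType) (G A : {group gT}) (t : gT).
Hypotheses (sAG : A \subset G) (iAG : #|G : A| = 2).
Hypotheses (Gt : t \in G) (nAt : t \notin A).

Lemma setD_index2 : G :\: A = A :* t.
Proof.
apply/esym/eqP; rewrite eqEcard card_rcoset; apply/andP; split.
  apply/subsetP=> _ /rcosetP[a Aa ->]; rewrite inE groupMl // nAt.
  by rewrite groupM // (subsetP sAG a).
by rewrite cardsD (setIidPr sAG) -(Lagrange sAG) iAG muln2 -addnn addnK.
Qed.

Lemma index2_mulr g : g \in G -> g \notin A -> exists2 a, a \in A & g = a * t.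
Proof.
by move=> Gg nAg; apply/rcosetP; rewrite -setD_index2 inE Gg nAg.
Qed.

Lemma index2_sqr : t * t \in A.
Proof.
have /index2_mulr : t^-1 \in G by rewrite groupV.
rewrite groupV => /(_ nAt)[a Aa e].
by rewrite -groupV invMg {1}e -mulgA mulgV mulg1.
Qed.

Lemma index2_center x : x \in G -> {in A, forall a, commute x a} ->
  commute x t -> x \in 'Z(G).
Proof.
move=> Gx cxA cxt; apply/centerP; split=> // g Gg.
have [/cxA // | nAg] := boolP (g \in A).
by have [a Aa ->] := index2_mulr Gg nAg; apply: commuteM => //; apply: cxA.
Qed.

Lemma index2_normal_sub (K : {set gT}) : abelian A -> K \subset A ->
  {in K, forall k, k ^ t \in K} -> G \subset 'N(K).
Proof.
move=> abA sKA Kt; apply/subsetP=> g Gg; rewrite inE; apply/subsetP=> _ /imsetP[k Kk ->].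
have cK a : a \in A -> k ^ a = k.
  by move=> Aa; apply/conjg_fixP/commgP/(centsP abA) => //; apply: (subsetP sKA).
have [/cK -> // | nAg] := boolP (g \in A).
by have [a Aa ->] := index2_mulr Gg nAg; rewrite conjgM cK // Kt.
Qed.

End IndexTwo.

(** * Pseudodihedral groups in terms of elements *)

Section PseudoDihedral.

Local Open Scope group_scope.

Variable (gT : finGroupType).
Implicit Types (G A : {group gT}) (t : gT).

(** The last field replaces the cyclicity of the Sylow 2-subgroup of [A]: the identity is counted
    too, so the bound 2 allows at most one involution. *)
Record inversion_extension G A t : Prop := InversionExtension {
  invext_sub : A \subset G;
  invext_index : #|G : A| = 2;
  invext_abelian : abelian A;
  invext_gt2 : 2 < #|A|;
  invext_in : t \in G;
  invext_notin : t \notin A;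
  invext_sqr : t * t = 1;
  invext_inv : {in A, forall x, x ^ t = x^-1};
  invext_involutions : #|[set x in A | x * x == 1]| <= 2
}.

(** The solutions of [x * x = 1] in [A] all lie in the first Ohm subgroup of its Sylow 2-subgroup,
    and an abelian 2-group is cyclic exactly when that subgroup has order at most 2. *)
Lemma pseudodihedralP G :
  reflect (exists A t, inversion_extension G A t) (pseudodihedral G).
Proof.
apply: (iffP existsP) => [[A /existsP[T]] | [A [t]]].
  case/and5P=> /eqP defG abA gtA cycA /andP[isoT /forall_inP invA].
  have oT : #|T| = 2 by rewrite (card_isog isoT) card_Zp.
  have [_ eG nAT tiAT] := sdprodP defG.
  have /card_gt0P[t] : 0 < #|T^#|.
    by move: oT; rewrite (cardsD1 1) group1 => -[e]; rewrite [X in 0 < X]e.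
  rewrite !inE => /andP[ntt Tt].
  have nAt : t \notin A.
    by apply: contra ntt => At; rewrite -in_set1 -[[set 1]]tiAT inE At.
  have sAG : A \subset G by rewrite -eG mulG_subl.
  have sTG : T \subset G by rewrite -eG mulG_subr.
  exists A, t; split => //.
  - by rewrite -divgS // -(sdprod_card defG) oT mulKn // cardG_gt0.
  - exact: (subsetP sTG).
  - by have := expg_cardG Tt; rewrite oT.
  - have Dt : t \in T^# by rewrite !inE ntt.
    by move=> x Ax; have /forall_inP/(_ x Ax)/eqP := invA t Dt.
  have [P sylP] := Sylow_exists 2 A.
  have /forallP/(_ P) := cycA; rewrite sylP /= => cycP.
  have abP := cyclic_abelian cycP.
  have : [set x in A | x * x == 1] \subset 'Ldiv_2(P).
    apply/subsetP=> x /[!inE]/andP[Ax xx]; rewrite (_ : x ^+ 2 == 1) // andbT.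
    have sPA := pHall_sub sylP.
    have nsPA : P <| A by rewrite -sub_abelian_normal.
    rewrite (mem_normal_Hall sylP nsPA Ax) /p_elt.
    by apply: (@pnat_dvd _ (2 ^ 1)); rewrite ?pnatX ?pnat_id // order_dvdn.
  move/subset_leq_card/leq_trans; apply.
  have pP := pHall_pgroup sylP; have [P1|ntP] := eqVneq (P : {set gT}) 1.
    by rewrite P1 (leq_trans (subset_leq_card (subsetIl _ _))) ?cards1.
  rewrite -[leqRHS](Ohm1_cyclic_pgroup_prime cycP pP ntP) subset_leq_card //.
  by rewrite (OhmE 1 pP) subset_gen.
case=> sAG iAG abA gtA Gt nAt tt inv le2.
have nsAG := index2_normal sAG iAG.
exists A; apply/existsP; exists <[t]>%G.
have ot : #[t] = 2.
  apply: nt_prime_order => //.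
  by apply: contraNneq nAt => ->.
have tiAt : A :&: <[t]> = 1 by rewrite setIC prime_TIg -?orderE ?ot // cycle_subG.
have nAt' : <[t]> \subset 'N(A) by rewrite cycle_subG (subsetP (normal_norm nsAG)).
apply/and5P; split=> //.
- have oG : #|G| = (#|A| * 2)%N by rewrite -iAG Lagrange.
  by rewrite sdprodE // eqEcard TI_cardMg // -orderE ot oG leqnn mul_subG ?cycle_subG.
- apply/forall_inP=> P sylP; have pP := pHall_pgroup sylP.
  have abP := abelianS (pHall_sub sylP) abA.
  rewrite abelian_rank1_cyclic // (rank_pgroup pP) p_rank_abelian //.
  have : #|'Ohm_1(P)| <= 2.
    apply: leq_trans le2; rewrite (OhmE 1 pP) (gen_set_id (group_Ldiv _ abP)).
    apply: subset_leq_card; apply/subsetP=> x /LdivP[Px xx]; rewrite inE.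
    by rewrite (subsetP (pHall_sub sylP)) //=; apply/eqP.
  by have := cardG_gt0 'Ohm_1(P); case: #|_| => [|[|[|]]].
apply/andP; split.
  by rewrite isog_sym -ot Zp_isog.
apply/forall_inP=> s; rewrite in_setD1 /= (cycle2g ot) in_set2.
case/andP=> nt1; rewrite (negPf nt1) /= => /eqP ->.
by apply/forall_inP=> x Ax; rewrite inv.
Qed.

End PseudoDihedral.

(** * Nonabelian groups with faithful units *)

Section NonabelianFaithful.

Local Open Scope group_scope.

Variables (gT : finGroupType) (G A : {group gT}) (t : gT).
Hypotheses (sAG : A \subset G) (iAG : #|G : A| = 2) (abA : abelian A).
Hypotheses (Gt : t \in G) (nAt : t \notin A) (nabG : ~~ abelian G).

Let oG : #|G| = (#|A| * 2)%N. Proof. by rewrite -iAG Lagrange. Qed.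

Let nAG : G \subset 'N(A). Proof. exact: normal_norm (index2_normal sAG iAG). Qed.

Let conj_in a g : a \in A -> g \in G -> a ^ g \in A.
Proof. by move=> Aa Gg; rewrite memJ_norm ?(subsetP nAG). Qed.

Let cAA a b : a \in A -> b \in A -> commute a b.
Proof. by move=> Aa Ab; apply: (centsP abA). Qed.

Let conj_id a b : a \in A -> b \in A -> a ^ b = a.
Proof. by move=> Aa Ab; apply/conjg_fixP/commgP/cAA. Qed.

Lemma index2_conj a g : a \in A -> g \in G -> g \notin A -> a ^ g = a ^ t.
Proof.
move=> Aa Gg nAg; have [c Ac ->] := index2_mulr sAG iAG Gt nAt Gg nAg.
by rewrite conjgM (conj_id Aa Ac).
Qed.

Lemma index2_conjV a : a \in A -> a ^ t^-1 = a ^ t.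
Proof. by move=> Aa; apply: index2_conj; rewrite ?groupV. Qed.

Lemma index2_mul_sqr a : a \in A -> (a * t) * (a * t) = (a * a ^ t) * (t * t).
Proof.
move=> Aa; rewrite -(index2_conjV Aa) conjgE invgK !mulgA.
by rewrite mulgKV.
Qed.

Lemma index2_fixed_center a : a \in A -> a ^ t = a -> a \in 'Z(G).
Proof.
move=> Aa fa; apply: (index2_center sAG iAG Gt nAt); first exact: (subsetP sAG).
  by move=> b; apply: cAA.
by apply/commgP/conjg_fixP.
Qed.

(** Conjugation by [t] swaps the two factors, because [t * t] lies in the abelian group [A]. *)
Lemma index2_norm_center a : a \in A -> a * a ^ t \in 'Z(G).
Proof.
move=> Aa; have At := conj_in Aa Gt.
apply: index2_fixed_center; first by rewrite groupM.
rewrite conjMg -(conjgM a) (conj_id Aa (index2_sqr sAG iAG Gt nAt)); exact: cAA.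
Qed.

Lemma index2_sqr_center : t * t \in 'Z(G).
Proof.
apply: index2_fixed_center; first exact: index2_sqr sAG iAG Gt nAt.
by rewrite conjgE -mulgA mulKg.
Qed.

(** A central element outside [A] would, together with [A], generate [G] and make it abelian. *)
Lemma index2_center_sub : 'Z(G) \subset A.
Proof.
apply/subsetP=> z Zz; apply: contraR nabG => nAz.
have Gz := subsetP (center_sub G) z Zz.
have cz x : x \in G -> commute x z by move=> Gx; apply/esym; case/centerP: Zz => _; apply.
have sAZ a : a \in A -> a \in 'Z(G).
  move=> Aa; apply: (index2_center sAG iAG Gz nAz); first exact: (subsetP sAG).
    by move=> b; apply: cAA.
  exact/cz/(subsetP sAG).
apply/center_idP/eqP; rewrite eqEsubset center_sub; apply/subsetP=> x Gx.
have [/sAZ // | nAx] := boolP (x \in A).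
by have [a Aa ->] := index2_mulr sAG iAG Gz nAz Gx nAx; rewrite groupM // sAZ.
Qed.

Lemma index2_gt2 : 2 < #|A|.
Proof.
rewrite ltnNge; apply: contra nabG => leA.
apply: (@p2group_abelian _ 2); rewrite /pgroup oG.
  by have := cardG_gt0 A; case: #|A| leA => [|[|[|]]].
by have := cardG_gt0 A; case: #|A| leA => [|[|[|]]].
Qed.

Variable u : 'Bx(G).
Hypotheses (fu : u \in bfaithful G) (ntu : u != 0%R).

(** If [t * t = 1], involutions of [A] are fixed by [t], hence central, and the centre has order at
    most 2. Otherwise every element outside [A] has the nontrivial square [t * t] in [A]; since
    subgroups of [A] are normal in [G], the sign -1 occurs only at 1, and [#|A|] would divide 2. *)
Lemma faithful_inversion : {in A, forall a, a ^ t = a^-1} -> pseudodihedral G.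
Proof.
move=> invA; have [tt|ntt] := eqVneq (t * t) 1.
  apply/pseudodihedralP; exists A, t; split=> //; first exact: index2_gt2.
  apply: leq_trans (faithful_card_center fu ntu); apply: subset_leq_card.
  apply/subsetP=> x; rewrite inE => /andP[Ax /eqP xx].
  by apply: index2_fixed_center; rewrite // invA // -[LHS]mulg1 -xx mulKg.
have core (K : {group gT}) : K \subset G -> mark (val u) K != 1%R -> K :=: 1.
  move=> sKG uK.
  have KA1 : K :&: A = 1.
    apply: (@faithful_core _ _ _ K (K :&: A)%G fu sKG uK); last exact: subsetIl.
    rewrite /normal subIset ?sKG //=.
    apply: (index2_normal_sub sAG iAG Gt nAt abA); first exact: subsetIr.
    by move=> k /setIP[Kk Ak]; rewrite invA // inE !groupV Kk.
  apply/trivgP; rewrite -KA1 subsetI subxx; apply/subsetP=> g Kg.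
  apply: contraR ntt => nAg; rewrite -in_set1 -[[set 1]]KA1 inE.
  rewrite (index2_sqr sAG iAG Gt nAt) andbT.
  have [a Aa e] := index2_mulr sAG iAG Gt nAt (subsetP sKG g Kg) nAg.
  by have := groupM Kg Kg; rewrite {1 2}e index2_mul_sqr // invA // mulgV mul1g.
have [K sKG uK] := bunits_neq0P ntu; have K1 := core K sKG uK.
have := dvd_card_neg1 u sAG; rewrite (_ : [set _ in _ | _] = [set 1]).
  by rewrite cards1 => /(dvdn_leq (isT : 0 < 2)); rewrite leqNgt index2_gt2.
apply/setP=> h; rewrite in_set1 inE; apply/andP/eqP => [[Ah uh]|->].
  apply/eqP; rewrite -cycle_eq1; apply/eqP/(core <[h]>%G) => //.
  by rewrite cycle_subG (subsetP sAG).
rewrite group1; split=> //; rewrite (_ : <[1]>%G = K) //.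
by apply: group_inj; rewrite K1 /= cycle1.
Qed.

(** Here the centre is [{1, z}]. A subgroup with sign -1 is cyclic and avoids [z], and its
    nontrivial elements in [A] are involutions [k] with [k * k ^ t = z]. If no such [k] generates a
    subgroup with sign -1, the counts force [u] to be trivial; if one does, [G] turns out to be
    dihedral of order 8, with another cyclic subgroup taking the place of [A]. *)
Lemma faithful_noninversion b : b \in A -> b ^ t != b^-1 -> pseudodihedral G.
Proof.
move=> Ab nib; set z := b * b ^ t.
have Zz : z \in 'Z(G) by apply: index2_norm_center.
have Az : z \in A := subsetP index2_center_sub z Zz.
have ntz : z != 1 by apply: contra nib => /eqP z1; rewrite eq_sym eq_invg_mul -/z z1.
have ZE : 'Z(G) = [set 1; z].
  apply/esym/eqP; rewrite eqEcard subUset !sub1set group1 Zz cards2 eq_sym ntz.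
  exact: faithful_card_center fu ntu.
have Z1z x : x \in 'Z(G) -> x = 1 \/ x = z.
  by rewrite ZE => /set2P.
have zz : z * z = 1.
  have [//|/eqP] := Z1z (z * z) (groupM Zz Zz).
  by rewrite -{3}[z]mulg1 (inj_eq (mulgI z)) (negPf ntz).
have zt : z ^ t = z.
  by apply/conjg_fixP/commgP; case/centerP: Zz => _; apply.
have norm_conj k : k \in A -> k * k ^ t = 1 \/ k * k ^ t = z.
  by move=> Ak; apply/Z1z/index2_norm_center.
have conjM k l : k \in A -> l \in A -> (k * l) * (k * l) ^ t = (k * k ^ t) * (l * l ^ t).
  move=> Ak Al; rewrite conjMg.
  have := conj_in Ak Gt; move: (k ^ t) (l ^ t) => k' l' Ak'.
  by rewrite -!mulgA; congr (_ * _); rewrite !mulgA (cAA Al Ak').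
have norm1 (K : {group gT}) k : K \subset G -> mark (val u) K != 1%R ->
    k \in K -> k \in A -> k * k ^ t = 1 -> k = 1.
  move=> sKG uK Kk Ak /eqP; rewrite -eq_invg_mul eq_sym => /eqP kt.
  have nsk : <[k]> <| G.
    rewrite /normal cycle_subG (subsetP sAG) //.
    apply: (index2_normal_sub sAG iAG Gt nAt abA); rewrite ?cycle_subG //.
    by move=> _ /cycleP[i ->]; rewrite conjXg kt groupX // groupV cycle_id.
  apply/eqP; rewrite -cycle_eq1; apply/eqP/(faithful_core fu sKG uK nsk).
  by rewrite cycle_subG.
have nKz (K : {group gT}) : K \subset G -> mark (val u) K != 1%R -> z \notin K.
  move=> sKG uK; apply: contra ntz => Kz.
  by apply/eqP/(norm1 K) => //; rewrite zt zz.
have norm2 (K : {group gT}) k : K \subset G -> mark (val u) K != 1%R ->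
    k \in K -> k \in A -> k != 1 -> k * k ^ t = z /\ k * k = 1.
  move=> sKG uK Kk Ak ntk; have [k1|kz] := norm_conj k Ak.
    by rewrite (norm1 K k) ?eqxx // in ntk.
  by split=> //; apply: (norm1 K) => //; rewrite ?groupM // conjM // kz zz.
have prodZ k l : k \in A -> l \in A -> k * k ^ t = z -> l * l ^ t = z ->
    (k * l) * (k * l) ^ t = 1.
  by move=> Ak Al ek el; rewrite conjM // ek el zz.
(* Inside [A], two nontrivial elements of [K] have a product of norm 1, hence trivial. If [K]
   contains [g] outside [A], a nontrivial [k] in [K :&: A] would put [k * k ^ g = z] into [K]. *)
have cyc (K : {group gT}) : K \subset G -> mark (val u) K != 1%R ->
    exists2 g, g \in G & K :=: <[g]>.
  move=> sKG uK; have [sKA|] := boolP (K \subset A).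
    have [->|ntK] := eqVneq (K : {set gT}) 1.
      by exists 1; rewrite ?cycle1.
    have [k Kk ntk] := trivgPn K ntK; have Ak := subsetP sKA k Kk.
    exists k; first exact: (subsetP sKG).
    apply/eqP; rewrite eqEsubset cycle_subG Kk andbT; apply/subsetP=> l Kl.
    have Al := subsetP sKA l Kl; have [->|ntl] := eqVneq l 1; first exact: group1.
    have [ek _] := norm2 K k sKG uK Kk Ak ntk.
    have [el _] := norm2 K l sKG uK Kl Al ntl.
    have /eqP : k * l = 1 by apply: (norm1 K); rewrite ?groupM //; apply: prodZ.
    by rewrite -eq_invg_mul => /eqP <-; rewrite groupV cycle_id.
  case/subsetPn=> g Kg nAg; have Gg := subsetP sKG g Kg.
  have KA1 k : k \in K -> k \in A -> k = 1.
    move=> Kk Ak; apply: contraNeq (nKz K sKG uK) => ntk.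
    have [<- _] := norm2 K k sKG uK Kk Ak ntk.
    by rewrite -(index2_conj Ak Gg nAg) groupM ?groupJ.
  exists g => //; apply/eqP; rewrite eqEsubset cycle_subG Kg andbT.
  apply/subsetP=> l Kl; have [Al|nAl] := boolP (l \in A).
    by rewrite (KA1 l) ?group1.
  have [c Ac lcg] := index2_mulr sAG iAG Gg nAg (subsetP sKG l Kl) nAl.
  rewrite lcg (KA1 c) ?mul1g ?cycle_id // -(mulgK g c) -lcg.
  by rewrite groupM ?groupV.
have sub1 h : h \in G -> <[h]> \subset G by rewrite cycle_subG.
pose D := [set h in A | mark (val u) <[h]>%G != 1%R].
have dvdA : #|A| %| #|D|.*2 by apply: dvd_card_neg1.
have gtA := index2_gt2.
have [sD1 | ] := boolP (D \subset [set 1]).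
  have D0 : #|D| = 0%N.
    have := subset_leq_card sD1; rewrite cards1; case: #|D| dvdA => [|[|]] // /dvdn_leq.
    by move/(_ isT); rewrite leqNgt gtA.
  have nD h : h \in A -> mark (val u) <[h]>%G = 1%R.
    move=> Ah; apply/eqP; rewrite -[_ == _]negbK; apply/negP=> uh.
    by move/eqP: D0; rewrite cards_eq0 => /eqP/setP/(_ h); rewrite !inE Ah uh.
  have [s Gs [nAs ss]] : exists2 s, s \in G & s \notin A /\ s * s = z.
    have [tt|tt] := Z1z (t * t) index2_sqr_center; last by exists t.
    exists (b * t); first by rewrite groupM // (subsetP sAG).
    by rewrite groupMl // nAt index2_mul_sqr // tt mulg1.
  pose E := [set h in G | mark (val u) <[h]>%G != 1%R].
  (* Since [<[s]>] contains [z], its sign is 1: one element outside [A] is lost, so [#|E| < #|A|],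
     although [#|A|] divides [#|E|]. *)
  have sEs : E \subset (G :\: A) :\ s.
    apply/subsetP=> h; rewrite !inE => /andP[Gh uh]; rewrite Gh andbT.
    apply/andP; split.
      apply: contraTneq uh => ->; apply/negP=> us.
      by have := nKz _ (sub1 s Gs) us; rewrite -ss groupM ?cycle_id.
    by apply: contraL uh => Ah; rewrite nD ?eqxx.
  have ltE : #|E| < #|A|.
    apply: leq_ltn_trans (subset_leq_card sEs) _.
    rewrite -[ltnRHS](card_rcoset A t) -(setD_index2 sAG iAG Gt nAt).
    by rewrite [ltnRHS](cardsD1 s) inE nAs Gs.
  have E0 : #|E| = 0%N.
    have := dvd_card_neg1 u (subxx G); rewrite -/E oG; case: #|E| ltE => // n ltn.
    by move/(dvdn_leq (isT : 0 < n.+1.*2)); rewrite muln2 leq_double leqNgt ltn.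
  have [K sKG uK] := bunits_neq0P ntu; have [g Gg Kg] := cyc K sKG uK.
  move/eqP: E0; rewrite cards_eq0 => /eqP/setP/(_ g); rewrite !inE Gg.
  by rewrite (_ : <[g]>%G = K) ?uK //; apply: group_inj; rewrite Kg.
case/subsetPn=> k; rewrite in_set1 inE => /andP[Ak uk] ntk.
have Gk := subsetP sAG k Ak.
have [ek kk] := norm2 <[k]>%G k (sub1 k Gk) uk (cycle_id k) Ak ntk.
have kt : k ^ t = k * z by rewrite -ek mulgA kk mul1g.
have Zk : k \notin 'Z(G).
  apply: contra ntz => /centerP[_ cGk]; have /commgP/conjg_fixP := cGk t Gt.
  by rewrite kt => /eqP; rewrite -{2}[k]mulg1 (inj_eq (mulgI k)).
(* For [l] in [D] other than 1, the involution [k * l] has norm 1, hence is central. With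
   [#|D| <= 3], the congruence gives [#|A| <= 6]. *)
have sDk : D \subset [set 1; k; k * z].
  apply/subsetP=> l; rewrite !inE => /andP[Al ul].
  have [//|ntl /=] := eqVneq l 1; have Gl := subsetP sAG l Al.
  have [el ll] := norm2 <[l]>%G l (sub1 l Gl) ul (cycle_id l) Al ntl.
  have klkl : (k * l) * (k * l) = 1.
    by rewrite mulgA -(mulgA k l k) (cAA Al Ak) mulgA kk mul1g.
  have := prodZ k l Ak Al ek el; rewrite -klkl => /mulgI.
  case/(index2_fixed_center (groupM Ak Al))/Z1z => e.
    by rewrite -[l]mul1g -kk -mulgA e mulg1 eqxx.
  by rewrite -[l]mul1g -kk -mulgA e eqxx orbT.
have ok : #[k] = 2 by apply: nt_prime_order => //; rewrite expgS expg1.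
have tiZ : <[k]> :&: 'Z(G) = 1 by rewrite prime_TIg -?orderE ?ok // cycle_subG.
have oV : #|<[k]> * 'Z(G)| = 4.
  rewrite TI_cardMg // -orderE ok.
  by rewrite [#|'Z(G)|](congr1 (fun S : {set gT} => #|S|) ZE) cards2 eq_sym ntz.
have sVA : <[k]> * 'Z(G) \subset A by rewrite mul_subG ?cycle_subG // index2_center_sub.
have oA : #|A| = 4.
  have ck : <[k]> <*> 'Z(G) = <[k]> * 'Z(G).
    by rewrite cent_joinEr // (subset_trans (subsetIr _ _)) // centS // cycle_subG.
  have dvd4 : 4 %| #|A| by rewrite -oV -ck; apply: cardSg; rewrite /= ck.
  have leD : #|D| <= 3.
    apply: leq_trans (subset_leq_card sDk) _; rewrite -setUA cardsU1 cards2.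
    by case: (1 \notin _); case: (k != _).
  have D_gt0 : 0 < #|D| by apply/card_gt0P; exists k; rewrite inE Ak uk.
  have := dvdn_leq _ dvdA; rewrite double_gt0 => /(_ D_gt0) leA.
  have leA6 : #|A| <= 6 by apply: leq_trans leA _; rewrite -(leq_double #|D| 3) in leD.
  by move: dvd4 gtA leA6; case: #|A| => [|[|[|[|[|[|[|]]]]]]].
have [s [Gs nAs ss]] : exists s, [/\ s \in G, s \notin A & s * s = 1].
  have [tt|tt] := Z1z (t * t) index2_sqr_center; first by exists t.
  exists (k * t); split; first by rewrite groupM.
    by rewrite groupMl.
  by rewrite index2_mul_sqr // ek tt zz.
have sV : s^-1 = s by apply/eqP; rewrite eq_invg_mul ss.
have ks : k ^ s = k * z by rewrite -kt; apply: index2_conj.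
(* The rotation of order 4, inverted by the involution [s]. *)
pose x := k * s.
have xx : x * x = z.
  have := ks; rewrite conjgE sV => e.
  by rewrite /x mulgA -(mulgA k s k) -(mulgA k) -(mulgA s k s) e mulgA kk mul1g.
have xs : x ^ s = x^-1.
  apply/eqP; rewrite eq_sym eq_invg_mul conjgE sV /x.
  by rewrite -(mulgA k s s) ss mulg1 mulgA -(mulgA k s s) ss mulg1 kk.
have Gx : x \in G by rewrite groupM.
have ox : #[x] = 4.
  have : #[x] %| 4 by rewrite order_dvdn (expgM x 2 2) !(expgS _ 1) !expg1 xx zz.
  have : ~~ (#[x] %| 2) by rewrite order_dvdn (expgS _ 1) expg1 xx.
  move=> n2 d4; have := dvdn_leq (isT : 0 < 4) d4; move: n2 d4.
  by case: #[x] => [|[|[|[|[|]]]]].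
have invB y : y \in <[x]> -> y ^ s = y^-1.
  by case/cycleP=> i ->; rewrite conjXg xs expgVn.
have nBs : s \notin <[x]>.
  apply: contra ntz => Bs; have : commute x s.
    by apply: (centsP (cycle_abelian x)); rewrite ?cycle_id.
  move=> cxs; have : x ^ s = x by apply/conjg_fixP/commgP.
  by rewrite xs => e; rewrite -xx -{1}e mulVg.
have sBG : <[x]> \subset G by rewrite cycle_subG.
have iBG : #|G : <[x]>| = 2 by rewrite -divgS // -orderE ox oG oA.
apply/pseudodihedralP; exists <[x]>%G, s; split=> //; rewrite ?cycle_abelian //.
  by rewrite -orderE ox.
apply: leq_trans (faithful_card_center fu ntu); apply: subset_leq_card.
apply/subsetP=> y; rewrite inE => /andP[By /eqP yy].
apply: (index2_center sBG iBG Gs nBs); first exact: (subsetP sBG).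
  by move=> w Bw; apply: (centsP (cycle_abelian x)).
by apply/commgP/conjg_fixP; rewrite invB // -[LHS]mulg1 -yy mulKg.
Qed.

Lemma faithful_nonabelian : pseudodihedral G.
Proof.
have [/forall_inP invA|] := boolP [forall a in A, a ^ t == a^-1].
  by apply: faithful_inversion => a Aa; apply/eqP/invA.
by case/forall_inPn=> b Ab; apply: faithful_noninversion.
Qed.

End NonabelianFaithful.

(** * Faithful units of pseudodihedral groups *)

Section SmallGroups.

Local Open Scope group_scope.

Variables (gT : finGroupType) (G : {group gT}).

Lemma bunits_eq (u v : 'Bx(G)) :
    (forall K : {group gT}, K \subset G ->
      (mark (val u) K != 1%R) = (mark (val v) K != 1%R)) ->
  u = v.
Proof.
move=> euv; apply/val_inj/mark_inj => K sKG; move: (euv K sKG).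
by case: (mark_unit (bunit_valP u) sKG) => ->; case: (mark_unit (bunit_valP v) sKG) => ->.
Qed.

Lemma bunits_sqr1 (a : 'B(G)) :
    (forall K : {group gT}, K \subset G -> mark a K = 1%R \/ mark a K = (- 1)%R) ->
  a \is a GRing.unit.
Proof.
move=> a1; apply/unitrP; exists a.
suff aa : (a * a = 1)%R by rewrite aa.
by apply: mark_inj => K sKG; rewrite markM // mark1 //; case: (a1 K sKG) => ->.
Qed.

(** In an abelian group every subgroup is normal, so the sign -1 can occur only at 1. *)
Lemma faithful_card2_uniq (u v : 'Bx(G)) : #|G| <= 2 ->
  u \in bfaithful G -> v \in bfaithful G -> u != 0%R -> v != 0%R -> u = v.
Proof.
move=> le2 fu fv ntu ntv; have abG : abelian G.
  have [->|ntG] := eqVneq (G : {set gT}) 1; first exact: abelian1.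
  apply/cyclic_abelian/prime_cyclic; have := cardG_gt1 G; rewrite ntG.
  by case: #|G| le2 => [|[|[|]]].
have uniq (w : 'Bx(G)) (K : {group gT}) : w \in bfaithful G -> w != 0%R ->
    K \subset G -> (mark (val w) K != 1%R) = (K :==: 1).
  move=> fw ntw sKG.
  have imp (L : {group gT}) : L \subset G -> mark (val w) L != 1%R -> L :=: 1.
    by move=> sLG wL; apply: (faithful_core fw sLG wL); rewrite // -sub_abelian_normal.
  apply/idP/eqP => [|K1]; first exact: imp.
  have [L sLG wL] := bunits_neq0P ntw; suff -> : K = L by [].
  by apply: group_inj; rewrite K1 (imp L).
by apply: bunits_eq => K sKG; rewrite !uniq.
Qed.

Definition reg_act (x : subg_of G) a := x * subg G a.
Lemma reg_is_action : is_action G reg_act.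
Proof.
split=> [a x y /mulIg // | x a b Ga Gb].
by rewrite /reg_act subgM // mulgA.
Qed.
Definition reg_action : action G (subg_of G) := Action reg_is_action.

Lemma fix_reg (H : {group gT}) : H \subset G ->
  #|'Fix_reg_action(H)| = if H :==: 1 then #|G| else 0%N.
Proof.
move=> sHG; have [->|ntH] := eqVneq (H : {set gT}) 1.
  by rewrite afix1 -(card_isog (isog_subg G)).
apply/eqP; rewrite cards_eq0 -subset0; apply/subsetP=> x /afixP fx.
have [h Hh /eqP[]] := trivgPn H ntH.
have := fx h Hh; rewrite /= /reg_act -[RHS]mulg1 => /mulgI /(congr1 sgval).
by rewrite subgK ?(subsetP sHG).
Qed.

Lemma Phi_trivial_exists : G :=: 1 -> exists2 u, u \in bfaithful G & u != 0%R.
Proof.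
move=> G1.
have aU : (- 1 : 'B(G))%R \is a GRing.unit by rewrite unitrN unitr1.
exists (BUnit aU).
  apply/bfaithfulP=> N K nsNG /eqP[]; apply/trivgP; rewrite -G1; exact: normal_sub nsNG.
by apply/bunits0P => /(_ G (subxx G)); rewrite /= markN ?mark1.
Qed.

(** The unit is [1 - G/1], with marks [1 - 2] at the trivial subgroup and 1 at [G]. *)
Lemma Phi_C2_exists : #|G| = 2 -> exists2 u, u \in bfaithful G & u != 0%R.
Proof.
move=> oG; pose a : 'B(G) := (1 - bclass reg_action)%R.
have ma (K : {group gT}) : K \subset G ->
    mark a K = if K :==: 1 then (- 1)%R else 1%R.
  by move=> sKG; rewrite markD // markN // mark1 // mark_class // fix_reg // oG; case: ifP.
have aU : a \is a GRing.unit.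
  by apply: bunits_sqr1 => K sKG; rewrite ma //; case: ifP; [right | left].
exists (BUnit aU).
  apply/bfaithfulP=> N K nsNG ntN sNK sKG; rewrite /= ma // ifN //.
  by apply: contra ntN => /eqP K1; apply/eqP/trivgP; rewrite -K1.
by apply/bunits0P => /(_ 1%G (sub1G G)); rewrite /= ma ?sub1G // eqxx.
Qed.

End SmallGroups.

Section InversionExtension.

Local Open Scope group_scope.

Variables (gT : finGroupType) (G A : {group gT}) (t : gT).
Hypothesis ext : inversion_extension G A t.

Let sAG := invext_sub ext.
Let iAG := invext_index ext.
Let abA := invext_abelian ext.
Let Gt := invext_in ext.
Let nAt := invext_notin ext.

Let oG : #|G| = (#|A| * 2)%N. Proof. by rewrite -iAG Lagrange. Qed.

Let sAGn : A <| G. Proof. exact: index2_normal. Qed.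

Lemma invext_conj g a : g \in G -> g \notin A -> a \in A -> a ^ g = a^-1.
Proof.
move=> Gg nAg Aa; have [b Ab ->] := index2_mulr sAG iAG Gt nAt Gg nAg.
rewrite conjgM (_ : a ^ b = a) ?(invext_inv ext) //.
by apply/conjg_fixP/commgP/(centsP abA).
Qed.

Lemma invext_outside_sqr g : g \in G -> g \notin A -> g * g = 1.
Proof.
move=> Gg nAg; have [b Ab ->] := index2_mulr sAG iAG Gt nAt Gg nAg.
have := invext_inv ext Ab; rewrite conjgE => e.
have tV : t^-1 = t by apply/eqP; rewrite eq_invg_mul (invext_sqr ext).
by rewrite -mulgA -{1}tV e mulgV.
Qed.

Lemma card_setD_invext : #|G :\: A| = #|A|.
Proof. by rewrite (setD_index2 sAG iAG Gt nAt) card_rcoset. Qed.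

(** Two elements of [K] outside [A] differ by an element of [K :&: A]. *)
Lemma invext_TI (K : {group gT}) : K \subset G -> K :&: A = 1 ->
  K :=: 1 \/ exists2 g, g \in G :\: A & K :=: <[g]>.
Proof.
move=> sKG KA1; have KA k : k \in K -> k \in A -> k = 1.
  by move=> Kk Ak; apply/eqP; rewrite -in_set1 -[[set 1]]KA1 inE Kk.
have [sKA|/subsetPn[g Kg nAg]] := boolP (K \subset A).
  by left; rewrite -KA1 (setIidPl sKA).
right; have Gg := subsetP sKG g Kg; exists g; first by rewrite inE nAg.
apply/eqP; rewrite eqEsubset cycle_subG Kg andbT.
apply/subsetP=> l Kl; have [Al|nAl] := boolP (l \in A).
  by rewrite (KA l) ?group1.
have [c Ac lcg] := index2_mulr sAG iAG Gg nAg (subsetP sKG l Kl) nAl.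
rewrite lcg (KA c) ?mul1g ?cycle_id // -(mulgK g c) -lcg.
by rewrite groupM ?groupV.
Qed.

Definition outer_cycle (K : {set gT}) := [exists g in G :\: A, K == <[g]>].

Lemma outer_order g : g \in G -> g \notin A -> #[g] = 2.
Proof.
move=> Gg nAg; apply: nt_prime_order => //; first by rewrite expgS expg1 invext_outside_sqr.
by apply: contraNneq nAg => ->.
Qed.

Lemma outer_cycleTI (K : {set gT}) : outer_cycle K -> K :&: A = 1.
Proof.
case/exists_inP=> g /setDP[Gg nAg] /eqP->.
by rewrite prime_TIg -?orderE ?outer_order // cycle_subG.
Qed.

(** A normal [<[g]>] meeting [A] trivially centralises [A]; as [g] also inverts [A], all of [A]
    would satisfy [x * x = 1], against [2 < #|A|]. *)
Lemma outer_cycle_normal (K : {group gT}) :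
  outer_cycle K -> ~~ (K <| G).
Proof.
move=> oK; apply/negP=> nsK; have := outer_cycleTI oK.
case/exists_inP: oK nsK => g /setDP[Gg nAg] /eqP-> nsg tig.
have /commG1P cgA : [~: <[g]>, A] = 1.
  apply/trivgP; rewrite -tig subsetI commg_subl commg_subr.
  have [sg ng] := andP nsg; apply/andP; split; first exact: subset_trans sAG ng.
  exact: subset_trans sg (normal_norm sAGn).
have : 2 < #|A| := invext_gt2 ext; rewrite ltnNge => /negP[].
apply: leq_trans (invext_involutions ext); apply: subset_leq_card.
apply/subsetP=> x Ax; rewrite inE Ax /=.
have : x ^ g = x.
  by apply/conjg_fixP/commgP/esym/(centsP cgA); rewrite ?cycle_id.
by rewrite (invext_conj Gg nAg Ax) => /eqP; rewrite eq_invg_mul.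
Qed.

(** Subgroups of [A] are normal in [G], so the sign -1 requires [K :&: A = 1]. It does not occur at
    1, or [#|A|] would divide 2. Hence the set [D] of elements generating a subgroup with sign -1
    lies in [G :\: A]; it is nonempty and [#|G|] divides [#|D|.*2], so it is all of [G :\: A]. *)
Lemma faithful_invext (u : 'Bx(G)) (K : {group gT}) :
  u \in bfaithful G -> u != 0%R -> K \subset G ->
  (mark (val u) K != 1%R) = outer_cycle K.
Proof.
move=> fu ntu sKG.
have TI (L : {group gT}) : L \subset G -> mark (val u) L != 1%R -> L :&: A = 1.
  move=> sLG uL; apply: (@faithful_core _ _ _ L (L :&: A)%G fu sLG uL); last exact: subsetIl.
  rewrite /normal subIset ?sLG //=.
  apply: (index2_normal_sub sAG iAG Gt nAt abA); first exact: subsetIr.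
  by move=> k /setIP[Lk Ak]; rewrite (invext_inv ext) // inE !groupV Lk.
have u1 : mark (val u) 1%G = 1%R.
  apply/eqP/negPn/negP=> u1; have := dvd_card_neg1 u sAG.
  rewrite (_ : [set _ in _ | _] = [set 1]).
    by rewrite cards1 => /(dvdn_leq (isT : 0 < 2)); rewrite leqNgt (invext_gt2 ext).
  apply/setP=> h; rewrite in_set1 inE; apply/andP/eqP => [[Ah uh]|->].
    have hG : <[h]> \subset G by rewrite cycle_subG (subsetP sAG).
    have := TI <[h]>%G hG uh; rewrite (setIidPl _) ?cycle_subG //= => h1.
    by apply/eqP; rewrite -cycle_eq1 h1.
  rewrite group1; split=> //; rewrite (_ : <[1]>%G = 1%G) //.
  by apply: group_inj; rewrite /= cycle1.
have outer (L : {group gT}) : L \subset G -> mark (val u) L != 1%R -> outer_cycle L.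
  move=> sLG uL; have [L1|[g Dg Lg]] := invext_TI sLG (TI L sLG uL).
    by rewrite (_ : L = 1%G) ?u1 // in uL; apply: group_inj.
  by apply/exists_inP; exists g; rewrite // Lg.
apply/idP/idP => [|/exists_inP[g Dg /eqP Kg]]; first exact: outer.
pose D := [set h in G | mark (val u) <[h]>%G != 1%R].
have sD : D \subset G :\: A.
  apply/subsetP=> h; rewrite !inE => /andP[Gh uh]; rewrite Gh andbT.
  have hG : <[h]> \subset G by rewrite cycle_subG.
  apply: contra (uh) => Ah; rewrite (_ : <[h]>%G = 1%G) ?u1 //; apply: group_inj.
  by have := TI <[h]>%G hG uh; rewrite (setIidPl _) ?cycle_subG.
have D_gt0 : 0 < #|D|.
  have [L sLG uL] := bunits_neq0P ntu.
  have /exists_inP[l /setDP[Gl _] /eqP Ll] := outer L sLG uL.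
  apply/card_gt0P; exists l; rewrite inE Gl (_ : <[l]>%G = L) //.
  by apply: group_inj; rewrite Ll.
have eD : D = G :\: A.
  apply/eqP; rewrite eqEcard sD card_setD_invext.
  have := dvd_card_neg1 u (subxx G); rewrite -/D oG => /dvdn_leq.
  by rewrite double_gt0 muln2 leq_double; apply.
have : g \in D by rewrite eD.
rewrite inE (_ : <[g]>%G = K) => [/andP[]//|]; by apply: group_inj; rewrite Kg.
Qed.

Lemma faithful_invext_uniq (u v : 'Bx(G)) :
  u \in bfaithful G -> v \in bfaithful G -> u != 0%R -> v != 0%R -> u = v.
Proof. by move=> fu fv ntu ntv; apply: bunits_eq => K sKG; rewrite !faithful_invext. Qed.

End InversionExtension.

(** * The G-set of cosets of a reflection *)

Section ReflectionCosets.

Local Open Scope group_scope.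

Variables (gT : finGroupType) (G A : {group gT}) (s : gT).
Hypotheses (sAG : A \subset G) (iAG : #|G : A| = 2).
Hypotheses (Gs : s \in G) (nAs : s \notin A) (ss : s * s = 1).

Lemma reflection_mem x g : x \in A -> g \in G -> g \notin A -> s * x * g \in A.
Proof.
move=> Ax Gg nAg; have [a Aa ->] := index2_mulr sAG iAG Gs nAs Gg nAg.
have sV : s^-1 = s by apply/eqP; rewrite eq_invg_mul ss.
have -> : s * x * (a * s) = (x * a) ^ s by rewrite conjgE sV !mulgA.
by rewrite memJ_norm ?groupM // (subsetP (normal_norm (index2_normal sAG iAG))).
Qed.

(* The action of G on the right cosets of <s>, each coset being represented   *)
(* by its unique element in A.                                                *)
Definition reflection_act (x : subg_of A) g : subg_of A :=
  if g \in A then x * subg A g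
  else if g \in G then subg A (s * sgval x * g) else x.

Lemma reflection_is_action : is_action G reflection_act.
Proof.
split=> [g x y | x g h Gg Gh].
  rewrite /reflection_act; case: ifP => [_ /mulIg // | /negbT nAg].
  case: ifP => // Gg /(congr1 sgval).
  by rewrite !subgK ?reflection_mem ?subgP // => /mulIg/mulgI/val_inj.
apply: val_inj; rewrite /reflection_act (groupM Gg Gh).
have xA := subgP x.
have [Ag|nAg] := boolP (g \in A); have [Ah|nAh] := boolP (h \in A).
- by rewrite groupM // subgM //= !subgK ?groupM // mulgA.
- have -> : s * sgval x * (g * h) = s * sgval (x * subg A g) * h.
    by rewrite /= subgK // !mulgA.
  by rewrite groupMl // (negPf nAh) Gh.
- rewrite groupMr // (negPf nAg) Gg /= mulgA.
  have Asg := reflection_mem xA Gg nAg.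
  by rewrite !subgK ?(groupM Asg Ah).
have Agh : g * h \in A.
  have [a Aa ->] := index2_mulr sAG iAG Gs nAs Gg nAg.
  by have := reflection_mem (group1 A) Gh nAh; rewrite mulg1 -mulgA; apply: groupM.
rewrite Agh Gg Gh /= !subgK ?reflection_mem //.
by rewrite !mulgA ss mul1g.
Qed.
Definition reflection_action : action G (subg_of A) := Action reflection_is_action.

Lemma fix_reflection (K : {group gT}) : K \subset G -> K :&: A != 1 ->
  #|'Fix_reflection_action(K)| = 0%N.
Proof.
move=> sKG /trivgPn[h /setIP[Kh Ah] nth1].
apply/eqP; rewrite cards_eq0 -subset0; apply/subsetP=> x /afixP fx.
have := fx h Kh; rewrite /= /reflection_act Ah -[RHS]mulg1 => /mulgI /(congr1 sgval).
by rewrite subgK //= => /eqP; rewrite (negPf nth1).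
Qed.

(** The element [g] fixes [x] exactly when [s ^ x = g], and the solutions in [A] are either none or
    a coset of ['C_A[s]]. *)
Lemma fix_reflection_cycle g : g \in G -> g \notin A -> g * g = 1 ->
  #|'Fix_reflection_action(<[g]>)| = ((g \in s ^: A) * #|'C_A[s]|)%N.
Proof.
move=> Gg nAg gg.
have gV : g^-1 = g by apply/eqP; rewrite eq_invg_mul gg.
have -> : #|'Fix_reflection_action(<[g]>)| = #|[set x in A | s ^ x == g]|.
  rewrite (afix_cycle_in reflection_action Gg) -(card_imset _ val_inj).
  apply: eq_card => x; rewrite inE; apply/imsetP/andP => [[y fy ->]|[Ax /eqP sx]].
    rewrite subgP; split=> //; move/afix1P: fy => /(congr1 sgval).
    rewrite /= /reflection_act (negPf nAg) Gg subgK ?reflection_mem ?subgP // => e.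
    have eg : s * sgval y = sgval y * g by rewrite -{2}e -mulgA gg mulg1.
    by rewrite conjgE eg mulKg.
  exists (subg A x); last by rewrite /= subgK.
  apply/afix1P/val_inj; rewrite /= /reflection_act (negPf nAg) Gg.
  by rewrite /= !subgK ?reflection_mem // -sx conjgE !mulgA -(mulgA _ x) mulgV mulg1 ss mul1g.
have [/imsetP[a Aa ->]|nc] := boolP (g \in _).
  rewrite mul1n -(card_rcoset 'C_A[s] a); apply: eq_card => x.
  rewrite inE mem_rcoset inE groupMr ?groupV //; congr (_ && _).
  rewrite -(can_eq (conjgKV a)) -!conjgM mulgV conjg1; apply/eqP/cent1P => [|/esym].
    by move/conjg_fixP/commgP/esym.
  by move/commgP/conjg_fixP.
apply/eqP; rewrite mul0n cards_eq0 -subset0.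
apply/subsetP=> x; rewrite inE => /andP[Ax /eqP e].
by rewrite -e memJ_class in nc.
Qed.

End ReflectionCosets.

(** * Existence of the faithful unit of a pseudodihedral group *)

Section InversionExtensionUnit.

Local Open Scope group_scope.

Variables (gT : finGroupType) (G A : {group gT}) (t : gT).
Hypothesis ext : inversion_extension G A t.

Let sAG := invext_sub ext.
Let iAG := invext_index ext.
Let abA := invext_abelian ext.
Let Gt := invext_in ext.
Let nAt := invext_notin ext.

Lemma invext_cent1 s : s \in G -> s \notin A ->
  'C_A[s] = [set x in A | x * x == 1].
Proof.
move=> Gs nAs; apply/setP=> x; rewrite in_setI [RHS]inE; have [Ax|//] := boolP (x \in A).
rewrite -eq_invg_mul -(invext_conj ext Gs nAs Ax) /=.
by apply/cent1P/eqP => [/commgP/conjg_fixP|/conjg_fixP/commgP].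
Qed.

Lemma invext_class_sub s : s \in G -> s \notin A -> s ^: A \subset G :\: A.
Proof.
move=> Gs nAs; apply/subsetP=> _ /imsetP[a Aa ->].
have Ga := subsetP sAG a Aa.
by rewrite inE memJ_norm ?nAs ?groupJ // (subsetP (normal_norm (index2_normal sAG iAG))).
Qed.

(** Each centraliser is the set [W] of solutions of [x * x = 1] in [A], so each [A]-class outside
    [A] has [#|A| / #|W|] elements. Either [#|W| = 1] and the only class is counted twice ([s = t]),
    or [#|W| = 2] and there are two classes. *)
Lemma invext_two_classes : exists2 s, s \in G :\: A &
  forall g, g \in G :\: A ->
    ((g \in t ^: A) * #|'C_A[t]| + (g \in s ^: A) * #|'C_A[s]|)%N = 2.
Proof.
pose W := [set x in A | x * x == 1].
have le2 : #|W| <= 2 := invext_involutions ext.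
have cl s : s \in G -> s \notin A -> (#|s ^: A| * #|W|)%N = #|A|.
  move=> Gs nAs; rewrite /W -(invext_cent1 Gs nAs) -index_cent1 mulnC.
  by rewrite Lagrange ?subsetIl.
have eqD (S : {set gT}) : S \subset G :\: A -> #|A| <= #|S| -> S = G :\: A.
  by move=> sS leS; apply/eqP; rewrite eqEcard sS (card_setD_invext ext).
have w_gt0 : 0 < #|W|.
  by apply/card_gt0P; exists 1; rewrite inE group1 mulg1 eqxx.
have clt := cl t Gt nAt; have sct := invext_class_sub Gt nAt.
have [w1|w1] := eqVneq #|W| 1%N.
  exists t; first by rewrite inE nAt.
  have et : t ^: A = G :\: A by apply: eqD => //; rewrite -clt w1 muln1.
  by move=> g Dg; rewrite et Dg !invext_cent1 // -/W w1.
have w2 : #|W| = 2 by lia.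
have [s Ds nts] : exists2 s, s \in G :\: A & s \notin t ^: A.
  apply/subsetPn; apply/negP=> /subset_leq_card.
  rewrite (card_setD_invext ext) -clt w2 muln2 -addnn.
  rewrite -[leqRHS]addn0 leq_add2l leqn0 cards_eq0.
  by move/eqP/setP/(_ t); rewrite class_refl inE.
exists s => //; have /setDP[Gs nAs] := Ds; have cls := cl s Gs nAs.
have dis : t ^: A :&: s ^: A = set0.
  apply/setP=> x; rewrite !inE; apply/negP=> /andP[xt xs].
  by case/negP: nts; apply: class_trans xt; rewrite class_sym.
have eU : t ^: A :|: s ^: A = G :\: A.
  apply: eqD; first by rewrite subUset sct invext_class_sub.
  rewrite cardsU dis cards0 subn0 -(leq_pmul2r (isT : 0 < 2)) mulnDl.
  by move: clt cls; rewrite w2 => -> ->; rewrite muln2 addnn.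
move=> g Dg; rewrite !invext_cent1 // -/W w2.
have := Dg; rewrite -eU inE => /orP[gt|gs].
  by rewrite gt; have := in_set0 g; rewrite -dis inE gt => /= ->.
by rewrite gs; have := in_set0 g; rewrite -dis inE gs andbT => ->.
Qed.

(** The marks of [1 - G/<t> - G/<s> + G/1] are [1 - 2] at an outer cycle, [1 - 2 #|A| + #|G| = 1] at
    the trivial subgroup, and 1 elsewhere. An outer cycle has prime order and is not normal, so it
    contains no nontrivial normal subgroup. *)
Lemma Phi_invext_exists : exists2 u, u \in bfaithful G & u != 0%R.
Proof.
have tt := invext_sqr ext.
have [s Ds cls] := invext_two_classes; have /setDP[Gs nAs] := Ds.
have ss : s * s = 1 by apply: invext_outside_sqr ext _ _ _.
have oG : #|G| = (#|A| * 2)%N by rewrite -iAG Lagrange.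
pose a : 'B(G) := (1 - bclass (reflection_action sAG iAG Gt nAt tt)
  - bclass (reflection_action sAG iAG Gs nAs ss) + bclass (reg_action G))%R.
have ma (K : {group gT}) : K \subset G ->
    mark a K = if outer_cycle G A K then (- 1)%R else 1%R.
  move=> sKG; rewrite !(markD, markN) // mark1 // !mark_class // fix_reg //.
  have [oK|noK] := boolP (outer_cycle G A K).
    have [g Dg /eqP Kg] := exists_inP oK; have /setDP[Gg nAg] := Dg.
    have K1 : K :!=: 1 by apply: contraNneq nAg => K1; rewrite -cycle_subG -Kg K1 sub1G.
    have gg := invext_outside_sqr ext Gg nAg.
    rewrite (negPf K1) Kg !fix_reflection_cycle //.
    by rewrite addr0 -addrA -opprD -PoszD cls.
  have [KA1|ntKA] := eqVneq (K :&: A) 1; last first.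
    rewrite !fix_reflection // ifN //; apply: contra ntKA => /eqP ->.
    by rewrite -subG1 subsetIl.
  have [->|[g Dg Kg]] := invext_TI ext sKG KA1; last first.
    by case/negP: noK; apply/exists_inP; exists g; rewrite // Kg.
  rewrite eqxx !afix1 -!(card_isog (isog_subg A)) oG; lia.
have aU : a \is a GRing.unit.
  by apply: bunits_sqr1 => K sKG; rewrite ma //; case: ifP; [right | left].
exists (BUnit aU).
  apply/bfaithfulP=> N K nsNG ntN sNK sKG; rewrite /= ma //; case: ifP => // oK.
  have [g Dg /eqP Kg] := exists_inP oK; have /setDP[Gg nAg] := Dg.
  case/negP: (outer_cycle_normal ext oK); suff -> : K = N by [].
  apply: group_inj; apply/eqP; rewrite eqEsubset sNK andbT; apply: contraR ntN => nsKN.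
  have oK2 : prime #|K| by rewrite Kg -orderE (outer_order ext).
  by rewrite -subG1 -(prime_TIg oK2 nsKN) subsetI sNK /=.
have tG : <[t]> \subset G by rewrite cycle_subG.
apply/bunits0P => /(_ <[t]>%G tG); rewrite /= ma // ifT //.
by apply/exists_inP; exists t; rewrite // inE nAt.
Qed.

End InversionExtensionUnit.

(** * The basis *)

Section Classification.

Local Open Scope group_scope.

Variables (gT : finGroupType) (G : {group gT}).

(** As an upper bound on the index, the condition passes to quotients without a case distinction. *)
Definition abelian_by_C2 : Prop :=
  exists A : {group gT}, [/\ A \subset G, abelian A & #|G : A| <= 2].

Lemma isog_Zp2 : (G \isog Zp 2) = (#|G| == 2).
Proof.
apply/idP/eqP => [/card_isog ->|oG]; first by rewrite card_Zp.
have cG : cyclic G by rewrite prime_cyclic // oG.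
have [x Gx] := cyclicP cG; have ox : #[x] = 2 by rewrite orderE -Gx oG.
by rewrite Gx isog_sym -ox Zp_isog.
Qed.

Lemma faithful_classification (u : 'Bx(G)) : abelian_by_C2 ->
    u \in bfaithful G -> u != 0%R ->
  [|| G :==: 1, G \isog Zp 2 | pseudodihedral G].
Proof.
case=> A [sAG abA iA] fu ntu.
have small : #|G| <= 2 -> [|| G :==: 1, G \isog Zp 2 | pseudodihedral G].
  move=> leG; rewrite isog_Zp2 trivg_card1 orbA.
  by have := cardG_gt0 G; case: #|G| leG => [|[|[|]]].
have [abG|nabG] := boolP (abelian G).
  exact/small/(faithful_abelian abG fu ntu).
have iAG : #|G : A| = 2.
  apply/eqP; rewrite eqn_leq iA ltn_neqAle eq_sym indexg_gt0 andbT.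
  by rewrite indexg_eq1; apply: contra nabG => sGA; apply: abelianS abA.
have [t Gt nAt] : exists2 t, t \in G & t \notin A.
  by apply/subsetPn; apply: contra nabG => sGA; apply: abelianS abA.
by rewrite (faithful_nonabelian sAG iAG abA Gt nAt nabG fu ntu) !orbT.
Qed.

Hypothesis spG : [|| G :==: 1, G \isog Zp 2 | pseudodihedral G].

Lemma Phi_neq0 : Phi G != 0%R.
Proof.
have [u fu ntu] : exists2 u, u \in bfaithful G & u != 0%R.
  case/or3P: spG => [/eqP G1|isoG|/pseudodihedralP[A [t ext]]].
  - exact: Phi_trivial_exists.
  - by apply: Phi_C2_exists; apply/eqP; rewrite -isog_Zp2.
  - exact: Phi_invext_exists ext.
rewrite /Phi vpick0; apply: contraNneq ntu => f0.
by move: fu; rewrite f0 memv0.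
Qed.

(** Shows that the choice made by [vpick] is immaterial. *)
Lemma Phi_uniq (u : 'Bx(G)) : u \in bfaithful G -> u != 0%R -> u = Phi G.
Proof.
move=> fu ntu; have fPhi : Phi G \in bfaithful G by apply: memv_pick.
case/or3P: spG => [/eqP G1|isoG|/pseudodihedralP[A [t ext]]].
- by apply: faithful_card2_uniq; rewrite ?Phi_neq0 // G1 cards1.
- apply: faithful_card2_uniq; rewrite ?Phi_neq0 //.
  by move: isoG; rewrite isog_Zp2 => /eqP ->.
- exact: (faithful_invext_uniq ext fu fPhi ntu Phi_neq0).
Qed.

End Classification.

Lemma abelian_by_C2_quotient (gT : finGroupType) (G N : {group gT}) :
  (N <| G)%g -> abelian_by_C2 G -> abelian_by_C2 (G / N)%G.
Proof.
move=> nsNG [A [sAG abA iA]]; exists (A / N)%G.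
rewrite quotientS ?quotient_abelian //; split=> //.
apply: leq_trans iA; apply: dvdn_leq; first exact: indexg_gt0.
apply: index_morphim; rewrite subIset //; apply/orP; left.
exact: normal_norm.
Qed.

(** * Independence and spanning of the inflated units *)

Section Inflation.

Local Open Scope group_scope.

Variables (gT : finGroupType) (G : {group gT}).

Lemma mark_inf_Phi (N : {N : {group gT} | N \in calN G}) (K : {group gT}) :
  K \subset G ->
  mark (val (inf_Phi N)) K = mark (val (Phi (G / val N)%G)) (K / val N)%G.
Proof. exact: mark_binf. Qed.

(** The image of [M] in [G / N] is a nontrivial normal subgroup contained in the image of [K]. *)
Lemma mark_inf_Phi1 (N : {N : {group gT} | N \in calN G}) (M K : {group gT}) :
  M <| G -> M \subset K -> K \subset G -> ~~ (M \subset val N) ->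
  mark (val (inf_Phi N)) K = 1%R.
Proof.
move=> nsMG sMK sKG nMN; rewrite mark_inf_Phi //.
have nsNG := calN_normal (valP N).
have /bfaithfulP : Phi (G / val N)%G \in bfaithful _ by apply: memv_pick.
move/(_ (M / val N)%G); apply; rewrite ?(quotient_normal _ nsMG) ?quotientS //.
rewrite -subG1 quotient_sub1 //.
exact: subset_trans (normal_sub nsMG) (normal_norm nsNG).
Qed.

Lemma mark_sum (I : finType) (J : {set I}) (F : I -> 'Bx(G)) (K : {group gT}) :
  K \subset G ->
  mark (val (\sum_(i in J) F i)%R) K = (\prod_(i in J) mark (val (F i)) K)%R.
Proof.
move=> sKG; apply: (big_morph (fun u : 'Bx(G) => mark (val u) K)).
  by move=> u v; rewrite /= markM.
by rewrite /= mark1.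
Qed.

(** For [N] of largest order in [J], no other member contains [N], so above [N] all other terms have
    sign 1 and [Phi] of [G / N] would be trivial. *)
Lemma inf_Phi_indep (J : {set {N : {group gT} | N \in calN G}}) :
  (\sum_(N in J) inf_Phi N = 0)%R -> J = set0.
Proof.
move=> sum0; have [//|[N1 J1]] := set_0Vmem J.
have [N JN maxN] := @arg_maxnP _ N1 (mem J) (fun N => #|val N|) J1.
have nsNG := calN_normal (valP N).
have spN : [|| G / val N :==: 1, G / val N \isog Zp 2 | pseudodihedral (G / val N)%G].
  by have := valP N; rewrite inE => /andP[].
have /eqP[] := Phi_neq0 spN; apply/eqP/bunits0P => Q sQ.
pose K := (coset (val N) @*^-1 Q)%G.
have sNK : val N \subset K by apply: sub_cosetpre.
have sKG : K \subset G by rewrite -(quotientGK nsNG) morphpreS.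
have -> : Q = (K / val N)%G by apply: group_inj; rewrite /= cosetpreK.
rewrite -mark_inf_Phi //.
have := congr1 (fun u : 'Bx(G) => mark (val u) K) sum0.
rewrite mark_sum // mark1 // (bigD1 N) //= big1 ?mulr1 // => M /andP[JM neMN].
apply: mark_inf_Phi1 nsNG sNK sKG _; apply: contra neMN => sNM.
apply/eqP/val_inj/group_inj/esym/eqP; rewrite eqEcard sNM.
exact: maxN.
Qed.

Lemma free_inf_Phi : free [seq inf_Phi N | N : {N : {group gT} | N \in calN G}].
Proof.
apply/(@freeP _ _ _ (codom_tuple (@inf_Phi gT G))) => k sum0 i.
(* Over the field with two elements, a linear combination is the sum over its support. *)
pose J := [set N | k (enum_rank N) != 0%R].
have J0 : J = set0.
  apply: inf_Phi_indep; rewrite -[RHS]sum0 (reindex_onto enum_rank enum_val) /=; last first.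
    by move=> j _; apply: enum_valK.
  rewrite big_mkcond /=; apply: eq_big => [N|N _].
    by rewrite enum_rankK eqxx.
  rewrite nth_codom enum_rankK inE.
  by case: (F2_cases (k (enum_rank N))) => -> ; rewrite ?eqxx ?scale0r ?scale1r.
apply/eqP/negPn; have := in_set0 (enum_val i); rewrite -J0 inE enum_valK.
by move/negbT.
Qed.

Hypothesis hG : abelian_by_C2 G.

Lemma inf_Phi_span (u : 'Bx(G)) :
  u \in <<[seq inf_Phi N | N : {N : {group gT} | N \in calN G}]>>%VS.
Proof.
(* The normal subgroups [M] with nontrivial deflation of [v] to [G / M]; their number is the
   induction measure. *)
pose nontriv (v : 'Bx(G)) := [set M : {group gT} | (M <| G) &&
  [exists K : {group gT}, [&& M \subset K, K \subset G & mark (val v) K != 1%R]]].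
have [n] := ubnP #|nontriv u|; elim: n u => // n IHn u ltn.
have [->|ntu] := eqVneq u 0%R; first exact: mem0v.
have u1 : 1%G \in nontriv u.
  have [K sKG uK] := bunits_neq0P ntu.
  by rewrite inE normal1; apply/existsP; exists K; rewrite sub1G sKG.
have [N uN maxN] := @arg_maxnP _ 1%G (mem (nontriv u)) (fun M => #|M|) u1.
have /[!inE]/andP[nsNG /existsP[K /and3P[sNK sKG uK]]] := uN.
have trivu (M L : {group gT}) : M <| G -> N \proper M -> M \subset L -> L \subset G ->
    mark (val u) L = 1%R.
  move=> nsMG ltNM sML sLG; apply/eqP/negPn/negP=> uL.
  have: M \in nontriv u by rewrite inE nsMG; apply/existsP; exists L; rewrite sML sLG.
  by move/maxN => /= leMN; have := proper_card ltNM; rewrite ltnNge leMN.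
pose v := bdeflx nsNG u.
have mv (Q : {group coset_of N}) : Q \subset G / N ->
    mark (val v) Q = mark (val u) (coset N @*^-1 Q)%G.
  exact: mark_bdefl.
have ntv : v != 0%R.
  apply: contraNneq uK => v0; have := mv (K / N)%G (quotientS N sKG).
  rewrite v0 mark1 ?quotientS // => ->; apply/eqP; congr (mark _ _).
  by apply: group_inj; rewrite /= quotientGK // (normalS sNK sKG).
have fv : v \in bfaithful (G / N)%G.
  apply/bfaithfulP=> M L nsM ntM sML sL; rewrite mv //.
  apply: (trivu (coset N @*^-1 M)%G).
  - by rewrite -(quotientGK nsNG) cosetpre_normal.
  - rewrite properE sub_cosetpre /=; apply: contra ntM => sMN.
    by rewrite -subG1 -(cosetpreK M) quotient_sub1 // (subset_trans sMN) ?normG.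
  - exact: morphpreS.
  - by rewrite -(quotientGK nsNG) morphpreS.
have spN := faithful_classification (abelian_by_C2_quotient nsNG hG) fv ntv.
have cN : N \in calN G by rewrite inE nsNG.
pose iN : {N : {group gT} | N \in calN G} := exist _ N cN.
have mI (L : {group gT}) : L \subset G ->
    mark (val (inf_Phi iN)) L = mark (val u) (N <*> L)%G.
  move=> sLG; rewrite mark_inf_Phi // -(Phi_uniq spN fv ntv) mv ?quotientS //.
  congr (mark _ _); apply: group_inj; rewrite /= quotientK ?norm_joinEr //;
    exact: subset_trans sLG (normal_norm nsNG).
(* The corrected unit has the sign of [u] at [L] times that at [N <*> L]; these cancel when [L]
   contains [N], which removes [N] from [nontriv]. *)
rewrite -[u](addrK (inf_Phi iN)) memvB //; last first.
  by apply: memv_span; apply/imageP; exists iN.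
have mw (L : {group gT}) : L \subset G ->
    mark (val (u + inf_Phi iN)%R) L = (mark (val u) L * mark (val u) (N <*> L)%G)%R.
  by move=> sLG; rewrite /= markM // mI.
have sNG := normal_sub nsNG.
apply: IHn; rewrite -ltnS; apply: leq_trans ltn; rewrite ltnS; apply: proper_card.
rewrite properE; apply/andP; split; last first.
  apply/subsetPn; exists N => //; rewrite inE nsNG /=; apply/existsPn=> L.
  apply/negP=> /and3P[sNL sLG /eqP[]]; rewrite mw //.
  rewrite (_ : (N <*> L)%G = L); last by apply: group_inj; apply/joing_idPr.
  by case: (mark_unit (bunit_valP u) sLG) => ->.
apply/subsetP=> M; rewrite !inE => /andP[nsMG /existsP[L /and3P[sML sLG wL]]].
rewrite nsMG /=; apply/existsP.
(* Nothing new enters [nontriv]: if the sign of [u] at [L] is 1, the sign -1 comes from [N <*> L],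
   which also contains [M]. *)
have [uL|uL] := eqVneq (mark (val u) L) 1%R; last by exists L; rewrite sML sLG.
exists (N <*> L)%G; rewrite join_subG sNG sLG (subset_trans sML) ?joing_subr //=.
by move: wL; rewrite mw // uL mul1r.
Qed.

End Inflation.

Theorem theorem5p10 (gT : finGroupType) (G : {group gT})
    (hG : exists A : {group gT},
      [/\ A \subset G, abelian A & #|G : A|%g = 1%N \/ #|G : A|%g = 2%N]) :
  basis_of (fullv : {vspace 'Bx(G)})
    [seq inf_Phi N | N : {N : {group gT} | N \in calN G}].
Proof.
have hG2 : abelian_by_C2 G.
  by case: hG => A [sAG abA iA]; exists A; split=> //; case: iA => ->.
rewrite /basis_of free_inf_Phi andbT eqEsubv subvf /=.
by apply/subvP=> u _; apply: inf_Phi_span.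
Qed.
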